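(* Let $f,g:\mathbb{R}^n\to(-\infty,+\infty]$ be proper, lower semicontinuous and prox-bounded with thresholds $\lambda_f,\lambda_g>0$, let $0<\mu<\bar\lambda=\min\{\lambda_f,\lambda_g\}$, $\alpha\in[0,1]$, and let $\varphi^{\alpha}_{\mu}=-e_{\mu}(-\alpha e_{\mu}f-(1-\alpha)e_{\mu}g)$ be the proximal average of $f$ and $g$. (a) The proximal average $\varphi^{\alpha}_{\mu}$ is always Clarke regular, prox-regular and strongly amenable on $\mathbb{R}^n$. (b) If one of the sets $\operatorname{conv}\operatorname{dom}f$ or $\operatorname{conv}\operatorname{dom}g$ is $\mathbb{R}^n$, then $\varphi^{\alpha}_{\mu}$ is locally Lipschitz on $\mathbb{R}^n$. (c) When $f,g$ are both $\mu$-proximal, $\varphi^{\alpha}_{\mu}$ is the proximal average for convex functions, i.e., it is given by the formula $$\varphi^{\alpha}_{\mu}(x)=\left[\alpha\Big(f+\tfrac{1}{2\mu}\|\cdot\|^2\Big)\Big(\tfrac{\cdot}{\alpha}\Big)\,\Box\,(1-\alpha)\Big(g+\tfrac{1}{2\mu}\|\cdot\|^2\Big)\Big(\tfrac{\cdot}{1-\alpha}\Big)\right](x)-\frac{1}{2\mu}\|x\|^2.$$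
   Context: $\|\cdot\|$ is the Euclidean norm. For a proper function $f$ and $\mu>0$, $e_{\mu}f(x)=\inf_{w}\{f(w)+\frac{1}{2\mu}\|w-x\|^2\}$. $f$ is prox-bounded if there exist $\lambda>0$ and $x$ with $e_{\lambda}f(x)>-\infty$; the supremum of all such $\lambda$ is its threshold $\lambda_f\in(0,+\infty]$. $f$ is $\mu$-proximal if $f+\frac{1}{2\mu}\|\cdot\|^2$ is convex. $\operatorname{conv}\operatorname{dom}f$ is the convex hull of the effective domain of $f$. $f_1\Box f_2(x)=\inf_w\{f_1(x-w)+f_2(w)\}$, and $\alpha h(\frac{\cdot}{\alpha})$ denotes $x\mapsto\alpha h(x/\alpha)$. Variational-analytic notions are in the sense of Rockafellar--Wets and are understood at points of the domain. A function $\varphi$ is Clarke regular at $\bar x\in\operatorname{dom}\varphi$ if $\operatorname{epi}\varphi$ is Clarke regular at $(\bar x,\varphi(\bar x))$, i.e., locally closed there with limiting normal cone equal to the regular (Fréchet) normal cone. An lsc $\varphi$ is prox-regular at $\bar x\in\operatorname{dom}\varphi$ if for every $\bar v\in\partial_L\varphi(\bar x)$ (limiting subdifferential) there exist $\varepsilon>0$, $\rho\ge0$ such that $\varphi(x')\ge\varphi(x)+\langle v,x'-x\rangle-\frac{\rho}{2}\|x'-x\|^2$ for all $\|x'-\bar x\|\le\varepsilon$ whenever $v\in\partial_L\varphi(x)$, $\|v-\bar v\|<\varepsilon$, $\|x-\bar x\|<\varepsilon$, $\varphi(x)<\varphi(\bar x)+\varepsilon$. $\varphi$ is strongly amenable at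 $\bar x\in\operatorname{dom}\varphi$ if on a neighborhood of $\bar x$ one has $\varphi=\theta\circ F$ with $F$ a $\mathcal{C}^2$ map into some $\mathbb{R}^m$, $\theta:\mathbb{R}^m\to(-\infty,+\infty]$ proper lsc convex, and the only $y\in N_{\operatorname{cl}\operatorname{dom}\theta}(F(\bar x))$ with $\nabla F(\bar x)^*y=0$ is $y=0$.
   Formalization: In (b) the function whose domain has convex hull R^n must carry nonzero weight (α>0 for f, α<1 for g), since (b) fails for α=0, f=0, g the indicator of {0}; in (c) the term 0·h(·/0) at α=0 or 1 is read as the indicator of {0}. *)

(* Defs.v *)
From HB Require Import structures.
From mathcomp Require Import all_boot all_order all_algebra.
From mathcomp Require Import all_classical all_reals all_analysis.

Set Implicit Arguments.
Unset Strict Implicit.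
Unset Printing Implicit Defensive.

Import Order.TTheory GRing.Theory Num.Theory.
Import numFieldNormedType.Exports.

Local Open Scope classical_set_scope.
Local Open Scope ring_scope.

(* The library norm on 'rV[R]_n is the sup norm, hence the explicit Euclidean
   structure.  Topological notions (nbhs, closure, limits, continuity,
   differentiability) are the library's: both norms induce the same ones. *)

Definition inner (R : realType) (n : nat) (x y : 'rV[R]_n) : R :=
  \sum_(i < n) x 0 i * y 0 i.

Definition enorm (R : realType) (n : nat) (x : 'rV[R]_n) : R :=
  Num.sqrt (inner x x).

Definition dom (R : realType) (n : nat) (f : 'rV[R]_n -> \bar R) :
    set 'rV[R]_n :=
  [set x | (f x < +oo)%E].

Definition proper_efun (R : realType) (n : nat) (f : 'rV[R]_n -> \bar R) : Prop :=
  (forall x, (-oo < f x)%E) /\ (exists x, dom f x).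

(* Only used for functions that do not take the value -oo, so that +oo + -oo
   never occurs on the right-hand side. *)
Definition convex_efun (R : realType) (n : nat) (f : 'rV[R]_n -> \bar R) :
    Prop :=
  forall (x y : 'rV[R]_n) (t : R), 0 < t -> t < 1 ->
    (f (t *: x + (1 - t) *: y)%R
       <= t%:E * f x + (1 - t)%:E * f y)%E.

Definition conv_hull (R : realType) (n : nat) (A : set 'rV[R]_n) :
    set 'rV[R]_n :=
  smallest (@convex_set R 'rV[R]_n) A.

Definition moreau_env (R : realType) (n : nat) (mu : R)
    (f : 'rV[R]_n -> \bar R) (x : 'rV[R]_n) : \bar R :=
  ereal_inf (range (fun w : 'rV[R]_n =>
    (f w + ((2 * mu)^-1 * enorm (w - x) ^+ 2)%:E)%E)).

Definition prox_params (R : realType) (n : nat) (f : 'rV[R]_n -> \bar R) :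
    set R :=
  [set lambda | 0 < lambda /\ exists x, (-oo < moreau_env lambda f x)%E].

Definition prox_bounded (R : realType) (n : nat) (f : 'rV[R]_n -> \bar R) :
    Prop :=
  prox_params f !=set0.

Definition prox_threshold (R : realType) (n : nat) (f : 'rV[R]_n -> \bar R) :
    \bar R :=
  ereal_sup (EFin @` prox_params f).

Definition add_quad (R : realType) (n : nat) (mu : R)
    (f : 'rV[R]_n -> \bar R) (x : 'rV[R]_n) : \bar R :=
  (f x + ((2 * mu)^-1 * enorm x ^+ 2)%:E)%E.

Definition proximal (R : realType) (n : nat) (mu : R)
    (f : 'rV[R]_n -> \bar R) : Prop :=
  convex_efun (add_quad mu f).

Definition prox_average (R : realType) (n : nat) (mu alpha : R)
    (f g : 'rV[R]_n -> \bar R) (x : 'rV[R]_n) : \bar R :=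
  (- moreau_env mu (fun w => - alpha%:E * moreau_env mu f w
                             - (1 - alpha)%:E * moreau_env mu g w) x)%E.

Definition inf_conv (R : realType) (n : nat) (f1 f2 : 'rV[R]_n -> \bar R)
    (x : 'rV[R]_n) : \bar R :=
  ereal_inf (range (fun w : 'rV[R]_n => (f1 (x - w)%R + f2 w)%E)).

(* x |-> a h(x/a); for a = 0 this is, as usual for epi-multiplication, the
   indicator function of {0}. *)
Definition epi_mult (R : realType) (n : nat) (a : R)
    (h : 'rV[R]_n -> \bar R) (x : 'rV[R]_n) : \bar R :=
  if a == 0 then (if x == 0 then 0%E else +oo%E)
  else (a%:E * h (a^-1 *: x))%E.

Definition locally_closed_at (R : realType) (n : nat) (C : set 'rV[R]_n)
    (xbar : 'rV[R]_n) : Prop :=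
  exists V : set 'rV[R]_n, [/\ nbhs xbar V, closed V & closed (C `&` V)].

(* v is a regular (Frechet) normal to C at xbar iff
   <v, x - xbar> <= o(|x - xbar|) for x in C. *)
Definition regular_normal (R : realType) (n : nat) (C : set 'rV[R]_n)
    (xbar : 'rV[R]_n) : set 'rV[R]_n :=
  [set v | C xbar /\ forall eps : R, 0 < eps ->
     \forall x \near xbar,
       C x -> inner v (x - xbar) <= eps * enorm (x - xbar)].

Definition limiting_normal (R : realType) (n : nat) (C : set 'rV[R]_n)
    (xbar : 'rV[R]_n) : set 'rV[R]_n :=
  [set v | C xbar /\ exists x_ v_ : nat -> 'rV[R]_n,
     [/\ forall k, regular_normal C (x_ k) (v_ k),
         x_ @ \oo --> xbar & v_ @ \oo --> v]].

Definition clarke_regular_set (R : realType) (n : nat) (C : set 'rV[R]_n)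
    (xbar : 'rV[R]_n) : Prop :=
  [/\ C xbar, locally_closed_at C xbar &
      limiting_normal C xbar = regular_normal C xbar].

(* R^n x R is represented by row vectors of length n + 1, the last coordinate
   being the height. *)
Definition epi (R : realType) (n : nat) (phi : 'rV[R]_n -> \bar R) :
    set 'rV[R]_(n + 1) :=
  [set p | (phi (lsubmx p) <= (rsubmx p 0 0)%:E)%E].

Definition clarke_regular (R : realType) (n : nat)
    (phi : 'rV[R]_n -> \bar R) (xbar : 'rV[R]_n) : Prop :=
  phi xbar \is a fin_num /\
  clarke_regular_set (epi phi) (row_mx xbar (fine (phi xbar))%:M).

Definition regular_subdiff (R : realType) (n : nat)
    (phi : 'rV[R]_n -> \bar R) (xbar : 'rV[R]_n) : set 'rV[R]_n :=
  [set v | phi xbar \is a fin_num /\ forall eps : R, 0 < eps ->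
     \forall x \near xbar,
       (phi xbar + (inner v (x - xbar) - eps * enorm (x - xbar))%:E
          <= phi x)%E].

Definition limiting_subdiff (R : realType) (n : nat)
    (phi : 'rV[R]_n -> \bar R) (xbar : 'rV[R]_n) : set 'rV[R]_n :=
  [set v | phi xbar \is a fin_num /\ exists x_ v_ : nat -> 'rV[R]_n,
     [/\ forall k, regular_subdiff phi (x_ k) (v_ k),
         x_ @ \oo --> xbar, phi \o x_ @ \oo --> phi xbar &
         v_ @ \oo --> v]].

Definition prox_regular (R : realType) (n : nat)
    (phi : 'rV[R]_n -> \bar R) (xbar : 'rV[R]_n) : Prop :=
  [/\ lower_semicontinuous phi, phi xbar \is a fin_num &
      forall vbar, limiting_subdiff phi xbar vbar ->
      exists eps rho : R, [/\ 0 < eps, 0 <= rho &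
        forall x v, limiting_subdiff phi x v ->
          enorm (v - vbar) < eps -> enorm (x - xbar) < eps ->
          (phi x < phi xbar + eps%:E)%E ->
          forall x', enorm (x' - xbar) <= eps ->
            (phi x + (inner v (x' - x)
                      - rho / 2 * enorm (x' - x) ^+ 2)%:E <= phi x')%E]].

(* In finite dimension, continuity of y |-> 'd F y for the operator norm is
   continuity of y |-> 'd F y v for every v. *)
Definition C1_on (R : realType) (n m : nat) (V : set 'rV[R]_n)
    (F : 'rV[R]_n -> 'rV[R]_m) : Prop :=
  forall x, V x -> differentiable F x /\
    forall v : 'rV[R]_n, {for x, continuous (fun y => 'd F y v)}.

Definition C2_on (R : realType) (n m : nat) (V : set 'rV[R]_n)
    (F : 'rV[R]_n -> 'rV[R]_m) : Prop :=
  C1_on V F /\ forall v : 'rV[R]_n, C1_on V (fun y => 'd F y v).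

(* 'J F x acts on row vectors from the right, 'd F x v = v *m 'J F x, so the
   adjoint of the derivative is y |-> y *m ('J F x)^T. *)
Definition strongly_amenable (R : realType) (n : nat)
    (phi : 'rV[R]_n -> \bar R) (xbar : 'rV[R]_n) : Prop :=
  phi xbar \is a fin_num /\
  exists (V : set 'rV[R]_n) (m : nat) (F : 'rV[R]_n -> 'rV[R]_m)
         (theta : 'rV[R]_m -> \bar R),
    [/\ open_nbhs xbar V /\ C2_on V F,
        [/\ proper_efun theta, lower_semicontinuous theta & convex_efun theta],
        forall x, V x -> phi x = theta (F x) &
        forall y, limiting_normal (closure (dom theta)) (F xbar) y ->
          y *m ('J F xbar)^T = 0 -> y = 0].

Definition locally_lipschitz (R : realType) (n : nat)
    (phi : 'rV[R]_n -> \bar R) : Prop :=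
  (forall x, phi x \is a fin_num) /\
  forall xbar, exists delta L : R, 0 < delta /\
    forall x y, enorm (x - xbar) < delta -> enorm (y - xbar) < delta ->
      `|fine (phi x) - fine (phi y)| <= L * enorm (x - y).

(* Main.v *)
(* Put c = 1 / (2 mu).  As mu is below both thresholds, e_mu f and e_mu g are
   finite, and Phi := phi + c |.|^2 is a supremum of affine functions, hence
   lsc and convex; it is proper because
   Phi (alpha z + (1 - alpha) z') <=
     alpha (f z + c |z|^2) + (1 - alpha) (g z' + c |z'|^2).     (A)
   Everything in (a) only uses that phi is convex up to the parabola c |.|^2:
   moving along segments turns a first-order (Frechet) normal or subgradient
   inequality into a global one with a quadratic error, and such global
   inequalities pass to limits; moreover phi x = theta (x, - c |x|^2) with
   theta (x, t) = Phi x + t convex.  For (b), (A) and the convexity of dom Phi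
   show that Phi is finite everywhere, and finite convex functions on R^n are
   locally Lipschitz.  For (c), (A) is one inequality; the other one is strong
   duality for the minimization of alpha F z + (1 - alpha) G z' subject to
   alpha z + (1 - alpha) z' = x with F = f + c |.|^2, G = g + c |.|^2, obtained by
   quadratic penalization: the level sets are compact because the conjugates of
   F and G are finite. *)
Require Import Defs.
From HB Require Import structures.
From mathcomp Require Import all_boot all_order all_algebra.
From mathcomp Require Import all_classical all_reals all_analysis.
From mathcomp Require Import ring lra zify.
Import Order.TTheory GRing.Theory Num.Theory.
Import numFieldNormedType.Exports.
Local Open Scope classical_set_scope.
Local Open Scope ring_scope.

Set Implicit Arguments.
Unset Strict Implicit.
Unset Printing Implicit Defensive.

(** * Euclidean structure of R^n *)

Section Euclidean.
Context {R : realType} {n : nat}.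
Implicit Types (x y z v : 'rV[R]_n) (a : R).

Lemma innerC x y : inner x y = inner y x.
Proof. by apply: eq_bigr => i _; rewrite mulrC. Qed.

Lemma innerDl x y z : inner (x + y) z = inner x z + inner y z.
Proof. by rewrite -big_split; apply: eq_bigr => i _; rewrite mxE mulrDl. Qed.

Lemma innerZl a x y : inner (a *: x) y = a * inner x y.
Proof. by rewrite mulr_sumr; apply: eq_bigr => i _; rewrite mxE mulrA. Qed.

Lemma innerNl x y : inner (- x) y = - inner x y.
Proof. by rewrite -scaleN1r innerZl mulN1r. Qed.

Lemma innerBl x y z : inner (x - y) z = inner x z - inner y z.
Proof. by rewrite innerDl innerNl. Qed.

Lemma innerDr x y z : inner z (x + y) = inner z x + inner z y.
Proof. by rewrite innerC innerDl !(innerC z). Qed.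

Lemma innerZr a x y : inner x (a *: y) = a * inner x y.
Proof. by rewrite innerC innerZl innerC. Qed.

Lemma innerNr x y : inner x (- y) = - inner x y.
Proof. by rewrite innerC innerNl innerC. Qed.

Lemma innerBr x y z : inner z (x - y) = inner z x - inner z y.
Proof. by rewrite innerDr innerNr. Qed.

Lemma inner0l x : inner 0 x = 0.
Proof. by rewrite -(scale0r 0) innerZl mul0r. Qed.

Lemma inner0r x : inner x 0 = 0.
Proof. by rewrite innerC inner0l. Qed.

Lemma inner_ge0 x : 0 <= inner x x.
Proof. by apply: sumr_ge0 => i _; rewrite -expr2 sqr_ge0. Qed.

Definition innerE :=
  (innerDl, innerDr, innerBl, innerBr, innerNl, innerNr, innerZl, innerZr).

Lemma enorm_sqr x : enorm x ^+ 2 = inner x x.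
Proof. by rewrite sqr_sqrtr // inner_ge0. Qed.

Lemma enorm_ge0 x : 0 <= enorm x.
Proof. exact: sqrtr_ge0. Qed.

Lemma enorm0 : enorm (0 : 'rV[R]_n) = 0.
Proof. by rewrite /enorm inner0l sqrtr0. Qed.

Lemma enormZ a x : enorm (a *: x) = `|a| * enorm x.
Proof. by rewrite /enorm !innerE mulrA -expr2 sqrtrM ?sqr_ge0// sqrtr_sqr. Qed.

Lemma enormN x : enorm (- x) = enorm x.
Proof. by rewrite -scaleN1r enormZ normrN1 mul1r. Qed.

Lemma enormB x y : enorm (x - y) = enorm (y - x).
Proof. by rewrite -opprB enormN. Qed.

Lemma coord_le_enorm x i : `|x 0 i| <= enorm x.
Proof.
rewrite -ler_sqr ?nnegrE ?enorm_ge0// enorm_sqr real_normK ?num_real//.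
rewrite /inner (bigD1 i)//= expr2 lerDl.
by apply: sumr_ge0 => j _; rewrite -expr2 sqr_ge0.
Qed.

Lemma rV_norm_le x a : 0 <= a -> (forall i, `|x 0 i| <= a) -> `|x| <= a.
Proof.
move=> a0 xa; rewrite /Num.Def.normr/= mx_normrE; apply/bigmax_leP; split=> //.
by move=> [i j] _ /=; rewrite ord1.
Qed.

Lemma norm_le_enorm x : `|x| <= enorm x.
Proof. by apply: rV_norm_le => [|i]; [exact: enorm_ge0|exact: coord_le_enorm]. Qed.

(** The constant [n.+1], instead of the sharp sqrt n, stays positive for n = 0 and can be divided
    by. *)
Lemma enorm_le_norm x : enorm x <= n.+1%:R * `|x|.
Proof.
rewrite -ler_sqr ?nnegrE ?enorm_ge0 ?mulr_ge0// enorm_sqr exprMn.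
apply: (@le_trans _ _ (n%:R * `|x| ^+ 2)).
  apply: (@le_trans _ _ (\sum_(i < n) `|x| ^+ 2)).
    apply: ler_sum => i _; rewrite -expr2 -[leLHS]real_normK ?num_real//.
    rewrite ler_sqr ?nnegrE// {2}/Num.Def.normr/= mx_normrE.
    exact: (le_bigmax _ (fun ij => `|x ij.1 ij.2|) (0, i)).
  by rewrite sumr_const card_ord mulr_natl.
by rewrite ler_wpM2r ?sqr_ge0// -natrX ler_nat -addn1; lia.
Qed.

Lemma enorm_eq0 x : enorm x = 0 -> x = 0.
Proof. by move=> x0; apply/eqP; rewrite -normr_le0 -x0 norm_le_enorm. Qed.

Lemma cauchy_schwarz x y : inner x y <= enorm x * enorm y.
Proof.
have [/enorm_eq0 ->|x0] := eqVneq (enorm x) 0; first by rewrite inner0l enorm0 mul0r.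
have [/enorm_eq0 ->|y0] := eqVneq (enorm y) 0; first by rewrite inner0r enorm0 mulr0.
have xgt0 : 0 < enorm x by rewrite lt_neqAle eq_sym x0 enorm_ge0.
have ygt0 : 0 < enorm y by rewrite lt_neqAle eq_sym y0 enorm_ge0.
(* With p = |x| |y|, this square equals 2 p (p - <x, y>). *)
have := inner_ge0 (enorm y *: x - enorm x *: y).
rewrite !innerE (innerC y x) -!enorm_sqr.
have := mulr_gt0 xgt0 ygt0; set p := _ * enorm y => p0 H.
have : 0 <= p * (p - inner x y) by rewrite /p; nra.
by rewrite pmulr_rge0// subr_ge0.
Qed.

Lemma enormD x y : enorm (x + y) <= enorm x + enorm y.
Proof.
rewrite -ler_sqr ?nnegrE ?addr_ge0 ?enorm_ge0// enorm_sqr !innerE (innerC y x).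
by rewrite -!enorm_sqr sqrrD; have := cauchy_schwarz x y; lra.
Qed.

(** Bridge from the Euclidean epsilon-delta arguments below to the library's neighbourhoods. *)
Lemma nbhs_enormP x (P : set 'rV[R]_n) :
  nbhs x P <-> exists2 d : R, 0 < d & forall y, enorm (y - x) < d -> P y.
Proof.
split.
- move=> /nbhs_ballP[d /= d0 dP]; exists d => // y yx; apply: dP.
  rewrite mx_norm_ball /ball_/= distrC.
  exact: le_lt_trans (norm_le_enorm _) yx.
- move=> [d d0 dP]; apply/nbhs_ballP; exists (n.+1%:R^-1 * d).
    by rewrite /= mulr_gt0 ?invr_gt0.
  move=> y; rewrite mx_norm_ball /ball_/= distrC => yx; apply: dP.
  apply: le_lt_trans (enorm_le_norm _) _.
  by rewrite -ltr_pdivlMl ?ltr0n.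
Qed.
End Euclidean.

Lemma inner_row_mx (R : realType) (n1 n2 : nat) (a b : 'rV[R]_n1) (u v : 'rV[R]_n2) :
  inner (row_mx a u) (row_mx b v) = inner a b + inner u v.
Proof.
by rewrite /inner big_split_ord; congr (_ + _); apply: eq_bigr => i _;
  rewrite ?(row_mxEl, row_mxEr).
Qed.

(** * Continuity of the inner product, cluster points and boundedness *)

Section Topology.
Context {R : realType}.

Lemma cvg_inner (n : nat) (T : Type) (F : set_system T) {FF : Filter F}
    (u v : T -> 'rV[R]_n) (a b : 'rV[R]_n) :
  u @ F --> a -> v @ F --> b -> inner (u t) (v t) @[t --> F] --> inner a b.
Proof.
move=> ua vb; rewrite /inner.
apply: cvg_big => [|i _]; first by move=> x; exact: add_continuous.
apply: cvgM.
  by apply: (cvg_comp u (fun M : 'rV_n => M 0 i) ua); exact: coord_continuous.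
by apply: (cvg_comp v (fun M : 'rV_n => M 0 i) vb); exact: coord_continuous.
Qed.

Lemma continuous_inner_sqr (n : nat) :
  continuous (fun x : 'rV[R]_n => inner x x).
Proof. by move=> x; apply: (@cvg_inner n _ (nbhs x) _ id id); exact: cvg_id. Qed.

(** Replaces the extraction of a convergent subsequence: a cluster point lies in the closure of
    every set of the filter, and the minimization arguments only test closed sets. *)
Lemma compact_seq (T : topologicalType) (A : set T) (u : nat -> T) :
  compact A -> (forall k, A (u k)) ->
  exists p, forall D : set T, closed D -> (\forall k \near \oo, D (u k)) -> D p.
Proof.
move=> cA Au; have uA : (u @ \oo) A by exists 0%N => // k _; exact: Au.
have [p [_ clp]] := cA (u @ \oo) _ uA.
exists p => D cD uD; rewrite ((closure_id D).1 cD).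
by move: clp; rewrite clusterE; apply.
Qed.

Lemma bounded_enorm (n : nat) (A : set 'rV[R]_n) (B : R) :
  (forall x, A x -> enorm x <= B) -> bounded_set A.
Proof.
move=> AB; exists B; split; first exact: num_real.
move=> M BM x /AB xB; apply: le_trans (norm_le_enorm x) _.
by apply: le_trans xB _; exact: ltW.
Qed.

End Topology.

(** * Lower semicontinuous and convex extended-real functions *)

Section Lsc.
Context {R : realType} {T : topologicalType}.
Implicit Types f g : T -> \bar R.

Lemma lsc_closed f (a : R) :
  lower_semicontinuous f -> closed [set x | (f x <= a%:E)%E].
Proof.
move=> /lower_semicontinuousP/(_ a) fo.
rewrite (_ : [set x | _] = ~` [set x | (a%:E < f x)%E]); first exact: open_closedC.
by apply/seteqP; split => x /=; rewrite leNgt => /negP.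
Qed.

Lemma lsc_continuous (h : T -> R) :
  continuous h -> lower_semicontinuous (EFin \o h).
Proof.
move=> ch x a; rewrite /= lte_fin => ax.
exists [set y | a < h y]; last by move=> y; rewrite /= lte_fin.
exact: cvgr_gt (ch x) _ ax.
Qed.

Lemma lscD f g : (forall x, (-oo < f x)%E) -> (forall x, (-oo < g x)%E) ->
  lower_semicontinuous f -> lower_semicontinuous g ->
  lower_semicontinuous (fun x => f x + g x)%E.
Proof.
move=> fNy gNy lf lg x a afg.
suff [b [c [bf cg abc]]] : exists b c : R,
    [/\ (b%:E < f x)%E, (c%:E < g x)%E & a <= b + c].
  have [V xV Vf] := lf _ _ bf; have [W xW Wg] := lg _ _ cg.
  exists (V `&` W); first exact: filterI.
  move=> y [/Vf yf /Wg yg]; apply: (@le_lt_trans _ _ (b + c)%:E).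
    by rewrite lee_fin.
  by rewrite EFinD; apply: lteD.
move: afg (fNy x) (gNy x); case: (f x) (g x) => [u||] [v||]//.
- rewrite -EFinD lte_fin => auv _ _; pose e := (u + v - a) / 2.
  by exists (u - e), (v - e); rewrite !lte_fin /e; split; lra.
- by move=> _ _ _; exists (u - 1), (a - u + 1); rewrite ltry lte_fin; split=> //; lra.
- by move=> _ _ _; exists (a - v + 1), (v - 1); rewrite ltry lte_fin; split=> //; lra.
- by move=> _ _ _; exists a, 0; rewrite !ltry addr0.
Qed.

Lemma lscZ (a : R) f : 0 < a ->
  lower_semicontinuous f -> lower_semicontinuous (fun x => a%:E * f x)%E.
Proof.
move=> a0 lf x b bf.
have [|V xV Vf] := lf x (a^-1 * b).
  by rewrite EFinM lte_pdivrMl.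
by exists V => // y /Vf; rewrite EFinM lte_pdivrMl.
Qed.

Lemma lsc_comp (S : topologicalType) (h : S -> T) f :
  continuous h -> lower_semicontinuous f -> lower_semicontinuous (f \o h).
Proof.
move=> ch lf x a /lf[V xV Vf]; exists (h @^-1` V); first exact: ch.
by move=> y /Vf.
Qed.
End Lsc.

Section Convex.
Context {R : realType} {n : nat}.
Implicit Types (f g : 'rV[R]_n -> \bar R) (x y : 'rV[R]_n).

Lemma convex_efun_le f x y (t a b : R) : convex_efun f -> 0 < t -> t < 1 ->
  (f x <= a%:E)%E -> (f y <= b%:E)%E ->
  (f (t *: x + (1 - t) *: y)%R <= (t * a + (1 - t) * b)%:E)%E.
Proof.
move=> cf t0 t1 fa fb; apply: le_trans (cf _ _ _ t0 t1) _.
rewrite [leRHS]EFinD !EFinM; apply: leeD; apply: lee_wpmul2l => //.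
  by rewrite lee_fin ltW.
by rewrite lee_fin subr_ge0 ltW.
Qed.

(** Real upper bounds replace extended arithmetic: as both weights are positive, a value +oo on the
    right makes the convexity inequality trivial. *)
Lemma convex_efun_of_le f : (forall x, (-oo < f x)%E) ->
  (forall x y (t a b : R), 0 < t -> t < 1 ->
    (f x <= a%:E)%E -> (f y <= b%:E)%E ->
    (f (t *: x + (1 - t) *: y)%R <= (t * a + (1 - t) * b)%:E)%E) ->
  convex_efun f.
Proof.
move=> fNy H x y t t0 t1.
have u0 : 0 < 1 - t by rewrite subr_gt0.
move: (H x y t) (fNy x) (fNy y).
case: (f x) (f y) => [a||] [b||]// H' _ _.
- by rewrite -!EFinM -EFinD; exact: H'.
- by rewrite gt0_muley ?lte_fin// addey// leey.
- by rewrite gt0_muley ?lte_fin// addye// leey.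
- by rewrite !gt0_muley ?lte_fin// leey.
Qed.

Lemma add_quad_le (mu a : R) f x :
  (add_quad mu f x <= a%:E)%E = (f x <= (a - (2 * mu)^-1 * inner x x)%:E)%E.
Proof. by rewrite /add_quad enorm_sqr EFinB leeBrDr. Qed.

Lemma add_quadNy (mu : R) f x : (-oo < f x)%E -> (-oo < add_quad mu f x)%E.
Proof. by rewrite /add_quad; case: (f x) => //= r _; rewrite -EFinD ltNyr. Qed.

Lemma lsc_add_quad (mu : R) f : (forall x, (-oo < f x)%E) ->
  lower_semicontinuous f -> lower_semicontinuous (add_quad mu f).
Proof.
move=> fNy lf; apply: lscD => //; first by move=> x; exact: ltNyr.
apply: (@lsc_continuous _ _ (fun x => (2 * mu)^-1 * enorm x ^+ 2)).
rewrite (_ : (fun x => _) = (fun x => (2 * mu)^-1 * inner x x)) => [x|].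
  apply: (@cvgM _ _ (nbhs x)); first exact: cvg_cst.
  exact: continuous_inner_sqr.
by apply/funext => x; rewrite enorm_sqr.
Qed.

(** Rearranges convexity of f + c |.|^2 through t |x|^2 + (1 - t) |y|^2 - |t x + (1 - t) y|^2 = t (1
    - t) |x - y|^2. Divided by t, the error tends to c |x - y|^2 as t tends to 0. *)
Lemma proximal_le (mu : R) f x y (t a b : R) : proximal mu f -> 0 < t -> t < 1 ->
  (f x <= a%:E)%E -> (f y <= b%:E)%E ->
  (f (t *: x + (1 - t) *: y)%R <=
     (t * a + (1 - t) * b
      + (2 * mu)^-1 * t * (1 - t) * inner (x - y) (x - y))%:E)%E.
Proof.
move=> pf t0 t1 fa fb; set c := (2 * mu)^-1.
have qa : (add_quad mu f x <= (a + c * inner x x)%:E)%E by rewrite add_quad_le addrK.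
have qb : (add_quad mu f y <= (b + c * inner y y)%:E)%E by rewrite add_quad_le addrK.
have := convex_efun_le pf t0 t1 qa qb.
rewrite add_quad_le -/c => /le_trans; apply; rewrite lee_fin !innerE (innerC y x).
by rewrite le_eqVlt; apply/orP; left; apply/eqP; ring.
Qed.

Lemma proximal_dom_convex (mu : R) f x y (t : R) : proximal mu f ->
  (forall x, (-oo < f x)%E) -> 0 < t -> t < 1 -> dom f x -> dom f y ->
  dom f (t *: x + (1 - t) *: y).
Proof.
move=> pf fNy t0 t1 dx dy.
have real_dom z : dom f z -> (f z <= (fine (f z))%:E)%E.
  by move=> dz; rewrite fineK// fin_real// fNy.
apply: le_lt_trans (proximal_le pf t0 t1 (real_dom _ dx) (real_dom _ dy)) _.
exact: ltry.
Qed.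
End Convex.

(** * Regularity of functions that are convex up to a parabola *)

(** The step length for moving along a segment: l N < d keeps the point in a neighbourhood, l M <= e
    makes the second-order term negligible. *)
Lemma small_step {R : realFieldType} (d e N M : R) :
  0 < d -> 0 < e -> 0 < N -> 0 < M ->
  exists l : R, [/\ 0 < l, l < 1, l * N < d & l * M <= e].
Proof.
move=> d0 e0 N0 M0; exists (Num.min 2^-1 (Num.min (d / (2 * N)) (e / M))).
have dN : 0 < d / (2 * N) by rewrite divr_gt0 ?mulr_gt0.
have eM : 0 < e / M by rewrite divr_gt0.
split.
- by rewrite !lt_min dN eM invr_gt0 ltr0n.
- by rewrite gt_min; apply/orP; left; lra.
- rewrite -ltr_pdivlMr// !gt_min; apply/orP; right; apply/orP; left.
  by rewrite invfM mulrCA ltr_pdivrMl// mulr_natl mulr2n ltrDl divr_gt0.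
- by rewrite -ler_pdivlMr// !ge_min lexx !orbT.
Qed.

Lemma le0_eps {R : realFieldType} (x C : R) : 0 < C ->
  (forall e, 0 < e -> x <= e * C) -> x <= 0.
Proof.
move=> C0 H; rewrite leNgt; apply/negP => x0.
have := H (x / C / 2) (divr_gt0 (divr_gt0 x0 C0) (ltr0n _ 2)).
rewrite mulrAC divfK ?gt_eqF//; lra.
Qed.

Section Split.
Context {R : realType} {n : nat}.
Implicit Types p q : 'rV[R]_(n + 1).

Lemma inner_split p q :
  inner p q = inner (lsubmx p) (lsubmx q) + rsubmx p 0 0 * rsubmx q 0 0.
Proof.
by rewrite -[p in LHS]hsubmxK -[q in LHS]hsubmxK inner_row_mx [X in _ + X]big_ord1.
Qed.

Lemma continuous_height : continuous (fun p : 'rV[R]_(n + 1) => rsubmx p 0 0).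
Proof.
move=> p; rewrite /= (_ : (fun _ => _) = (fun q => q 0 (rshift n 0))).
  exact: coord_continuous.
by apply/funext => q; rewrite !mxE.
Qed.
End Split.

Section ProximalRegularity.
Context {R : realType} {n : nat} (mu : R) (phi : 'rV[R]_n -> \bar R).
Hypotheses (mu_gt0 : 0 < mu) (phiNy : forall x, (-oo < phi x)%E).
Hypotheses (lsc_phi : lower_semicontinuous phi) (prox_phi : proximal mu phi).
Let c := (2 * mu)^-1.

Let c_ge0 : 0 <= c.
Proof. by rewrite invr_ge0 mulr_ge0 ?ltW. Qed.

Lemma closed_epi : closed (epi phi).
Proof.
pose psi (p : 'rV[R]_(n + 1)) := (phi (lsubmx p) + (- rsubmx p 0 0)%:E)%E.
rewrite (_ : epi phi = [set p | (psi p <= 0)%E]).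
  apply: lsc_closed; apply: lscD => //; first by move=> p; exact: ltNyr.
    exact: (lsc_comp (f := phi) (@continuous_lsubmx _ 1 n 1)).
  apply: (@lsc_continuous _ _ (fun p : 'rV_(n + 1) => - rsubmx p 0 0)) => p.
  by apply: (@cvgN _ _ _ (nbhs p)); exact: continuous_height.
by apply/seteqP; split => p /=; rewrite /psi/= EFinN sube_le0.
Qed.

(* The point (1 - l) p + l q, raised by c l (1 - l) |d|^2, stays in the epigraph;
   divide the Frechet inequality there by l and let l tend to 0. *)
Lemma regular_normal_epi p v : epi phi p -> regular_normal (epi phi) p v ->
  forall q, epi phi q -> inner v (q - p)
    + rsubmx v 0 0 * (c * inner (lsubmx (q - p)) (lsubmx (q - p))) <= 0.
Proof.
move=> ep [_ vp] q eq; set e := q - p; set d := lsubmx e.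
set k : 'rV[R]_(n + 1) := row_mx 0 (c * inner d d)%:M.
have -> : rsubmx v 0 0 * (c * inner d d) = inner v k.
  by rewrite inner_split row_mxKl row_mxKr inner0r add0r !mxE eqxx mulr1n.
set N := enorm e + enorm k + 1.
have N0 : 0 < N by rewrite ltr_wpDl ?addr_ge0 ?enorm_ge0.
(* The Frechet inequality costs at most eps N, and replacing (1 - l) k by k at most eps more. *)
apply: (@le0_eps _ _ (N + 1)) => [|eps eps0]; first by rewrite addr_gt0.
have /nbhs_enormP[dl dl0 H] := vp _ eps0.
have M0 : 0 < `|inner v k| + 1 by rewrite ltr_wpDl.
have [l [l0 l1 lN lM]] := small_step dl0 eps0 N0 M0.
have nN : enorm (e + (1 - l) *: k) <= N.
  apply: le_trans (enormD _ _) _; rewrite enormZ gtr0_norm ?subr_gt0//.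
  by rewrite /N; have := enorm_ge0 k; nra.
have pq : p + l *: (e + (1 - l) *: k) - p = l *: (e + (1 - l) *: k).
  by rewrite addrAC subrr add0r.
have := H (p + l *: (e + (1 - l) *: k)); rewrite pq.
rewrite !enormZ gtr0_norm// => /(_ _ _)/wrap[].
- by apply: le_lt_trans lN; rewrite ler_pM2l.
- rewrite /epi/=.
  have := proximal_le prox_phi l0 l1 eq ep.
  rewrite (_ : l *: lsubmx q + _ = lsubmx (p + l *: (e + (1 - l) *: k))).
    move=> /le_trans; apply; rewrite lee_fin -/c.
    rewrite (_ : lsubmx q - lsubmx p = d); last by rewrite /d linearB.
    rewrite /k !(row_mxEr, mxE) eqxx mulr1n.
    by rewrite le_eqVlt; apply/orP; left; apply/eqP; ring.
  by rewrite /k; apply/rowP => i; rewrite !(row_mxEl, mxE); ring.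
rewrite innerZr mulrCA ler_pM2l// !innerE => H1.
have : eps * enorm (e + (1 - l) *: k) <= eps * N by rewrite ler_pM2l.
have := ler_norm (inner v k); have := normr_ge0 (inner v k).
by rewrite mulrDr mulr1; nra.
Qed.

(** With s the last coordinate of v, the quadratic term is at most eps |q - p| on the ball of radius
    eps / (|s| c + 1). Regular normals are thus the solutions of inequalities that are continuous in
    (p, v). *)
Lemma regular_normal_epiP p v : epi phi p -> 
  (forall q, epi phi q -> inner v (q - p)
    + rsubmx v 0 0 * (c * inner (lsubmx (q - p)) (lsubmx (q - p))) <= 0) ->
  regular_normal (epi phi) p v.
Proof.
move=> ep H; split=> // eps eps0; apply/nbhs_enormP.
set s := rsubmx v 0 0.
have M0 : 0 < `|s| * c + 1 by rewrite ltr_wpDl// mulr_ge0.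
exists (eps / (`|s| * c + 1)); first by rewrite divr_gt0.
move=> q; rewrite ltr_pdivlMr// => qp /H; set d := q - p in qp *.
rewrite -subr_ge0 add0r -subr_ge0.
have : inner (lsubmx d) (lsubmx d) <= enorm d ^+ 2.
  by rewrite enorm_sqr inner_split lerDl -expr2 sqr_ge0.
have := inner_ge0 (lsubmx d); set i := inner (lsubmx d) _.
have := enorm_ge0 d; have := ler_norm (- s); rewrite normrN.
set E := enorm d in qp *.
move=> s1 E0 i0 iE H1.
have : - s * (c * i) <= `|s| * (c * E ^+ 2).
  apply: (@le_trans _ _ (`|s| * (c * i))).
    by apply: ler_wpM2r => //; rewrite mulr_ge0.
  by do 2 apply: ler_wpM2l => //.
have : E * (E * (`|s| * c + 1)) <= E * eps by rewrite ler_wpM2l// ltW.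
rewrite -/s in H1; nra.
Qed.

(** For fixed q, the inequality of [regular_normal_epi] at (x_k, v_k) passes to the limit, and
    [regular_normal_epiP] reads the limit as a regular normal. Constant sequences give the other
    inclusion. *)
Lemma proximal_clarke_regular x : dom phi x -> clarke_regular phi x.
Proof.
move=> dx; have fx : phi x \is a fin_num by rewrite fin_real// phiNy.
have ex : epi phi (row_mx x (fine (phi x))%:M).
  by rewrite /epi/= row_mxKl row_mxKr mxE eqxx mulr1n fineK.
split=> //; split=> //.
  exists setT; split; [exact: filterT|exact: closedT|].
  by rewrite setIT; exact: closed_epi.
apply/seteqP; split => v; last first.
  move=> rv; split=> //; exists (cst (row_mx x (fine (phi x))%:M)), (cst v).
  by split=> //; exact: cvg_cst.
move=> [_ [x_ [v_ [rv xx vv]]]]; apply: regular_normal_epiP => // q eq.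
pose F k := inner (v_ k) (q - x_ k) + rsubmx (v_ k) 0 0 *
   (c * inner (lsubmx (q - x_ k)) (lsubmx (q - x_ k))).
apply: (@ler_cvg_to _ (\oo : set_system nat) _ _ F (cst 0)).
- have qx : q - x_ k @[k --> \oo] --> q - row_mx x (fine (phi x))%:M.
    by apply: cvgB => //; exact: cvg_cst.
  have lqx : lsubmx (q - x_ k) @[k --> \oo] -->
      lsubmx (q - row_mx x (fine (phi x))%:M).
    by apply: (cvg_comp (fun k => q - x_ k) lsubmx qx); exact: continuous_lsubmx.
  apply: cvgD; first exact: cvg_inner.
  apply: cvgM.
    by apply: (cvg_comp v_ (fun p : 'rV_(n + 1) => rsubmx p 0 0) vv);
      exact: continuous_height.
  by apply: cvgM; [exact: cvg_cst|exact: cvg_inner].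
- exact: cvg_cst.
- by apply: nearW => k; apply: regular_normal_epi eq => //; case: (rv k).
Qed.

(** The Frechet inequality is taken at x + l (y - x), where [proximal_le] bounds phi from above;
    then divide by l and let l tend to 0. *)
Lemma regular_subdiff_ge x v a : phi x = a%:E -> regular_subdiff phi x v ->
  forall y b, (phi y <= b%:E)%E ->
    a + inner v (y - x) - c * inner (y - x) (y - x) <= b.
Proof.
move=> xa [_ vx] y b yb; set d := y - x.
set N := enorm d + 1.
have N0 : 0 < N by rewrite ltr_wpDl ?enorm_ge0.
rewrite -subr_le0; apply: (@le0_eps _ _ N) => // eps eps0.
have /nbhs_enormP[dl dl0 H] := vx _ eps0.
have [l [l0 l1 lN _]] := small_step dl0 eps0 N0 N0.
have pq : x + l *: d - x = l *: d by rewrite addrAC subrr add0r.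
have := H (x + l *: d); rewrite pq.
rewrite !enormZ gtr0_norm// => /(_ _)/wrap[].
  by apply: le_lt_trans lN; rewrite ler_pM2l// lerDl.
have xa' : (phi x <= a%:E)%E by rewrite xa.
have Ed : l *: y + (1 - l) *: x = x + l *: d.
  by apply/rowP => i; rewrite !mxE; ring.
have := proximal_le prox_phi l0 l1 yb xa'; rewrite Ed xa => Hle /le_trans/(_ Hle).
rewrite -EFinD lee_fin innerZr -/d -/c => H1; rewrite -(ler_pM2l l0).
have : 0 <= l * l * (c * inner d d) by rewrite mulr_ge0 ?mulr_ge0 ?inner_ge0// ltW.
have : 0 <= l * eps by rewrite mulr_ge0// ltW.
by rewrite /N; lra.
Qed.

Lemma limiting_subdiff_ge x v a : phi x = a%:E -> limiting_subdiff phi x v ->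
  forall y b, (phi y <= b%:E)%E ->
    a + inner v (y - x) - c * inner (y - x) (y - x) <= b.
Proof.
move=> xa [_ [x_ [v_ [rv xx px vv]]]] y b yb.
have fx k : phi (x_ k) = (fine (phi (x_ k)))%:E by rewrite fineK//; case: (rv k).
pose F k := fine (phi (x_ k)) + inner (v_ k) (y - x_ k)
  - c * inner (y - x_ k) (y - x_ k).
apply: (@ler_cvg_to _ (\oo : set_system nat) _ _ F (cst b)).
- have yx : y - x_ k @[k --> \oo] --> y - x by apply: cvgB => //; exact: cvg_cst.
  (* Convergence of the values, built into the limiting subdifferential, carries the leading term to
     the limit. *)
  move: px; rewrite xa => /fine_cvgP[_ px].
  apply: cvgB; first by apply: cvgD => //; exact: cvg_inner.
  by apply: cvgM; [exact: cvg_cst|exact: cvg_inner].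
- exact: cvg_cst.
- by apply: nearW => k; exact: (regular_subdiff_ge (fx k) (rv k) yb).
Qed.

Lemma proximal_prox_regular x : dom phi x -> prox_regular phi x.
Proof.
move=> dx; have fx : phi x \is a fin_num by rewrite fin_real// phiNy.
(* The subgradient inequality is global, so radius 1 will do; rho = 1 / mu gives rho / 2 = c. *)
split=> // vbar _; exists 1, mu^-1; split => // [|y v vy _ _ _ z _].
  by rewrite invr_ge0 ltW.
have fy : phi y = (fine (phi y))%:E by case: vy => fy _; rewrite fineK.
rewrite fy; move: (phiNy z); case Ez: (phi z) => [b||]// _; last by rewrite leey.
rewrite -EFinD lee_fin enorm_sqr.
have -> : mu^-1 / 2 = c by rewrite /c invfM mulrC.
rewrite addrA; apply: (limiting_subdiff_ge fy vy).
by rewrite Ez.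
Qed.
End ProximalRegularity.

(** * The smooth map x |-> (x, - c |x|^2) *)

Section Differentiation.
Context {R : realType}.

Lemma is_diff_eps (V W : normedModType R) (f : V -> W) (L : {linear V -> W}) x :
  continuous L ->
  (forall eps : R, 0 < eps ->
     \forall h \near (0 : V), `|f (h + x) - f x - L h| <= eps * `|h|) ->
  is_diff x f L.
Proof.
move=> cL H.
have E : f \o shift x = cst (f x) + L +o_ (0 : V) id.
  apply/eqaddoP => eps eps0; near=> h.
  rewrite -[(_ - _) h]/(f (h + x) - (f x + L h)) opprD addrA.
  by near: h; exact: H.
have dE := diff_unique cL E.
by split=> //; apply/diff_locallyP; rewrite dE; split.
Unshelve. all: by end_near. Qed.

Lemma continuous_mulmxr (m n : nat) (M : 'M[R]_(m, n)) :
  continuous (mulmxr M : 'rV_m -> 'rV_n).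
Proof.
rewrite (_ : _ M = fun x : 'rV_m => \sum_(i < m) x 0 i *: row i M); last first.
  by apply/funext => x; rewrite /= mulmx_sum_row.
apply: continuous_big => [x|i _ x]; first exact: add_continuous.
by apply: (@cvgZr_tmp _ _ _ (nbhs x)); exact: coord_continuous.
Qed.

Lemma is_diff_mulmxr (m n : nat) (M : 'M[R]_(m, n)) (x : 'rV_m) :
  is_diff x (mulmxr M : 'rV_m -> 'rV_n) (mulmxr M).
Proof.
by split; [exact/linear_differentiable/continuous_mulmxr
          |exact/diff_lin/continuous_mulmxr].
Qed.

Context {n : nat} (c : R).

Definition lift_quad (x : 'rV[R]_n) : 'rV[R]_(n + 1) :=
  row_mx x (- (c * inner x x))%:M.

(** The derivative h |-> (h, - 2 c <h, x>) in the row convention. The identity block later recovers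
    the horizontal part of a normal. *)
Definition lift_quad_jac (x : 'rV[R]_n) : 'M[R]_(n, n + 1) :=
  row_mx 1%:M (- (2 * c) *: x^T).

Lemma mul_lift_quad_jac (x h : 'rV[R]_n) :
  h *m lift_quad_jac x = row_mx h (- (2 * c * inner h x))%:M.
Proof.
rewrite mul_mx_row mulmx1 -scalemxAr; congr row_mx; apply/rowP => i.
rewrite ord1 !mxE eqxx mulr1n -[RHS]mulNr; congr (_ * _).
by apply: eq_bigr => j _; rewrite mxE.
Qed.

Lemma is_diff_lift_quad (x : 'rV[R]_n) :
  is_diff x lift_quad (mulmxr (lift_quad_jac x)).
Proof.
apply: is_diff_eps => [|eps eps0]; first exact: continuous_mulmxr.
(* The remainder is exactly (0, - c |h|^2). N dominates |c| (n + 1), the factor that appears when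
   one Euclidean norm of h is exchanged for the library norm. *)
apply/nbhs_enormP; set N := n.+1%:R ^+ 2 * `|c| + 1.
have N0 : 0 < N by rewrite ltr_wpDl// mulr_ge0// exprn_ge0.
exists (eps / N) => [|h]; first by rewrite divr_gt0.
rewrite subr0 ltr_pdivlMr// => hN.
rewrite /= mul_lift_quad_jac.
rewrite (_ : _ - _ = row_mx 0 (- (c * inner h h))%:M); last first.
  apply/rowP => i; rewrite /lift_quad; case: (split_ordP i) => j ->.
    by rewrite !(row_mxEl, mxE); ring.
  rewrite !(row_mxEr, mxE) ord1 eqxx !mulr1n !innerE (innerC x h); ring.
apply: le_trans (norm_le_enorm _) _.
have -> : enorm (row_mx (0 : 'rV[R]_n) (- (c * inner h h))%:M) = `|c| * enorm h ^+ 2.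
  rewrite /enorm inner_split row_mxKl row_mxKr inner0l add0r mxE eqxx mulr1n.
  by rewrite -expr2 sqrtr_sqr normrN normrM [`|inner h h|]ger0_norm ?inner_ge0//
    sqr_sqrtr ?inner_ge0.
have := enorm_le_norm h; have := enorm_ge0 h; have := normr_ge0 h.
move: hN; rewrite /N; set E := enorm h; set m := n.+1%:R : R.
have m1 : 1 <= m by rewrite ler1n.
have := normr_ge0 c; set C := `|c|; set k := `|h|.
move=> C0 hN k0 E0 Ek.
have : E * (C * m) <= eps.
  apply: le_trans (ltW hN); apply: ler_wpM2l => //.
  have : m * C <= m ^+ 2 * C by rewrite ler_wpM2r// expr2 ler_peMl// ltW//
      (lt_le_trans ltr01).
  by lra.
move=> H; have : C * E * E <= C * E * (m * k) by rewrite ler_wpM2l// mulr_ge0.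
have : E * (C * m) * k <= eps * k by rewrite ler_wpM2r.
lra.
Qed.

(** For fixed v, the derivative y |-> (v, - 2 c <v, y>) is affine in y, so its own differential is
    constant. *)
Lemma C2_lift_quad : C2_on setT lift_quad.
Proof.
have dE v : (fun y => 'd lift_quad y v) =
    (fun y => row_mx v 0 + mulmxr (row_mx 0 (- (2 * c) *: v^T)) y).
  apply/funext => y; rewrite (@diff_val _ _ _ _ _ _ _ (is_diff_lift_quad y)) /=.
  rewrite mul_lift_quad_jac mul_mx_row mulmx0 add_row_mx addr0 add0r; congr row_mx.
  apply/rowP => i.
  rewrite ord1 -scalemxAr !mxE eqxx mulr1n -[LHS]mulNr innerC; congr (_ * _).
  by apply: eq_bigr => j _; rewrite mxE.
have dv v x : is_diff x (fun y => 'd lift_quad y v)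
    (mulmxr (row_mx 0 (- (2 * c) *: v^T))).
  rewrite dE.
  apply: (is_diff_eq (is_diffD (is_diff_cst (row_mx v 0) x) (is_diff_mulmxr _ x))).
  by rewrite add0r.
split=> [x _|v x _]; split.
- exact: (@ex_diff _ _ _ _ _ _ _ (is_diff_lift_quad x)).
- by move=> v; apply: differentiable_continuous; exact: (@ex_diff _ _ _ _ _ _ _ (dv v x)).
- exact: (@ex_diff _ _ _ _ _ _ _ (dv v x)).
- move=> w.
  rewrite (_ : (fun y => _) = cst (mulmxr (row_mx 0 (- (2 * c) *: v^T)) w)).
    exact: cst_continuous.
  by apply/funext => y; rewrite (@diff_val _ _ _ _ _ _ _ (dv v y)).
Qed.

Lemma jacobian_lift_quad (x : 'rV[R]_n) : 'J lift_quad x = lift_quad_jac x.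
Proof.
apply/row_matrixP => i; rewrite !rowE mul_rV_lin1.
by rewrite (@diff_val _ _ _ _ _ _ _ (is_diff_lift_quad x)).
Qed.
End Differentiation.

(** * Strong amenability *)

Section StrongAmenability.
Context {R : realType} {n : nat} (mu : R) (phi : 'rV[R]_n -> \bar R).
Hypotheses (mu_gt0 : 0 < mu) (phi_proper : proper_efun phi).
Hypotheses (lsc_phi : lower_semicontinuous phi) (prox_phi : proximal mu phi).
Let c := (2 * mu)^-1.
Let theta (p : 'rV[R]_(n + 1)) : \bar R :=
  (add_quad mu phi (lsubmx p) + (rsubmx p 0 0)%:E)%E.

Let theta_shift p (t : R) : theta (p + row_mx 0 t%:M) = (theta p + t%:E)%E.
Proof.
rewrite /theta !linearD/= row_mxKl row_mxKr addr0 -[RHS]addeA; congr (_ + _)%E.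
by rewrite -EFinD !mxE eqxx mulr1n.
Qed.

Let theta_le p (a : R) :
  (theta p <= a%:E)%E = (add_quad mu phi (lsubmx p) <= (a - rsubmx p 0 0)%:E)%E.
Proof. by rewrite [in RHS]EFinB [RHS]leeBrDr. Qed.

(* The domain of theta is invariant under vertical translations. *)
Let limiting_normal_dom_theta p y :
  limiting_normal (closure (dom theta)) p y -> rsubmx y 0 0 = 0.
Proof.
move=> [_ [x_ [v_ [rv xp vy]]]].
have v0 k : rsubmx (v_ k) 0 0 = 0.
  have [clx H] := rv k; set s := rsubmx (v_ k) 0 0.
  apply/eqP; rewrite -normr_le0; apply: (@le0_eps _ _ 1) => // eps eps0; rewrite mulr1.
  have /nbhs_enormP[d d0 Hd] := H _ eps0.
  (* The sign of s orients the shift so that <v_k, (0, t)> = |t| |s|; the length d / 2 stays within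
     the ball. *)
  pose t := d / 2 * Num.sg s.
  have nE : enorm (row_mx (0 : 'rV[R]_n) t%:M) = `|t|.
    by rewrite /enorm inner_split row_mxKl row_mxKr inner0l add0r mxE eqxx mulr1n -expr2
      sqrtr_sqr.
  have [s0|s0] := eqVneq s 0; first by rewrite s0 normr0 ltW.
  have nt : `|t| = d / 2 by rewrite normrM normr_sg s0 mulr1 gtr0_norm// divr_gt0.
  have := Hd (x_ k + row_mx 0 t%:M); rewrite addrAC subrr add0r nE nt.
  move=> /(_ _ _)/wrap[]; first by lra.
    (* The shifted point is again in the closure: pull a neighbourhood of it back to x_k, meet
       [dom theta] there, and shift the common point. *)
    have sc : continuous (fun p : 'rV[R]_(n + 1) => p + row_mx 0 t%:M).
      by move=> q; apply: (@cvgD _ _ _ (nbhs q)); [exact: cvg_id|exact: cvg_cst].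
    move=> B /sc /clx[q [dq Bq]]; exists (q + row_mx 0 t%:M); split=> //.
    by move: dq; rewrite /dom/= theta_shift; case: (theta q) => //= r _;
      rewrite -EFinD ltry.
  rewrite inner_split row_mxKl row_mxKr inner0r add0r -/s [_%:M _ _]mxE eqxx mulr1n.
  by rewrite /t mulrCA [s * _]mulrC -normrEsg [leLHS]mulrC ler_pM2r// divr_gt0.
have cv : rsubmx (v_ k) 0 0 @[k --> \oo] --> rsubmx y 0 0.
  apply: (cvg_comp v_ (fun p : 'rV_(n + 1) => rsubmx p 0 0) vy).
  exact: continuous_height.
have E : (fun k => rsubmx (v_ k) 0 0) = cst 0 by apply/funext => k; exact: v0.
rewrite E in cv; exact: norm_cvg_unique cv (cvg_cst _).
Qed.

Lemma proximal_strongly_amenable x : dom phi x -> strongly_amenable phi x.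
Proof.
have [phiNy [x0 dx0]] := phi_proper.
move=> dx; have fx : phi x \is a fin_num by rewrite fin_real// phiNy.
have PhiNy y : (-oo < add_quad mu phi y)%E by exact: add_quadNy.
have thetaF y : phi y = theta (lift_quad c y).
  rewrite /theta /lift_quad row_mxKl row_mxKr mxE eqxx mulr1n.
  by rewrite /add_quad enorm_sqr -addeA -EFinD subrr adde0.
have thetaNy p : (-oo < theta p)%E.
  by rewrite /theta; have := PhiNy (lsubmx p); case: (add_quad _ _ _) => //= r _;
    rewrite -EFinD ltNyr.
split=> //; exists setT, (n + 1)%N, (lift_quad c), theta; split.
- split; last exact: C2_lift_quad.
  by split; [exact: openT|].
- split.
  + by split=> //; exists (lift_quad c x0); rewrite /dom/= -thetaF.
  + apply: lscD => //; first by move=> p; exact: ltNyr.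
      apply: (lsc_comp (f := add_quad mu phi) (@continuous_lsubmx _ 1 n 1)).
      exact: lsc_add_quad.
    exact: (@lsc_continuous _ _ (fun p : 'rV_(n + 1) => rsubmx p 0 0) continuous_height).
  + apply: convex_efun_of_le => // p q t a b t0 t1; rewrite !theta_le => pa qb.
    have := convex_efun_le prox_phi t0 t1 pa qb.
    rewrite !linearD !linearZ/= => /le_trans; apply; rewrite lee_fin !mxE.
    by rewrite le_eqVlt; apply/orP; left; apply/eqP; ring.
- by move=> y _; exact: thetaF.
(* Constraint qualification: the vertical part of y vanishes, so y times the transposed Jacobian is
   the horizontal part of y. *)
- move=> y /limiting_normal_dom_theta y0; rewrite jacobian_lift_quad.
  have yr : rsubmx y = 0 by apply/rowP => i; rewrite ord1 y0 mxE.
  rewrite -[y in y *m _]hsubmxK tr_row_mx mul_row_col yr mul0mx addr0 trmx1 mulmx1 => yl.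
  by rewrite -[y]hsubmxK yl yr row_mx0.
Qed.
End StrongAmenability.

(** * Local Lipschitz continuity of finite convex functions *)

Section LocalLipschitz.
Context {R : realType} {n : nat} (h : 'rV[R]_n -> R).
Hypothesis convex_h : forall x y (t : R), 0 <= t -> t <= 1 ->
  h (t *: x + (1 - t) *: y) <= t * h x + (1 - t) * h y.

(* Each added coordinate halves the admissible box:
   x0 + u + v is the midpoint of x0 + 2 u and x0 + 2 v. *)
Lemma convex_bounded_box (x0 : 'rV[R]_n) (s : seq 'I_n) :
  exists r M : R, 0 < r /\ forall c : 'I_n -> R, (forall i, `|c i| <= r) ->
    h (x0 + \sum_(i <- s) c i *: delta_mx 0 i) <= M.
Proof.
elim: s => [|i s [r [M [r0 IH]]]].
  by exists 1, (h x0); split=> // c _; rewrite big_nil addr0.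
pose e : 'rV[R]_n := delta_mx 0 i.
exists (r / 2), (2^-1 * (`|h (x0 + r *: e)| + `|h (x0 - r *: e)|) + 2^-1 * M).
split=> [|c cr]; first by rewrite divr_gt0.
rewrite big_cons -/e.
have -> : x0 + (c i *: e + \sum_(j <- s) c j *: delta_mx 0 j) =
    2^-1 *: (x0 + (2 * c i) *: e)
    + (1 - 2^-1) *: (x0 + \sum_(j <- s) (2 * c j) *: delta_mx 0 j).
  under [in RHS]eq_bigr do rewrite -scalerA.
  rewrite -scaler_sumr; set S := \sum_(j <- s) _.
  by apply/rowP => j; rewrite !mxE; field.
apply: le_trans (convex_h _ _ _ _) _; [lra|lra|].
have HM : h (x0 + \sum_(j <- s) (2 * c j) *: delta_mx 0 j) <= M.
  by apply: IH => j; rewrite normrM gtr0_norm//; have := cr j; lra.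
(* The point lies between x0 - r e and x0 + r e, so convexity bounds h by the two end values. *)
have HK : h (x0 + (2 * c i) *: e) <= `|h (x0 + r *: e)| + `|h (x0 - r *: e)|.
  pose t := (2 * c i + r) / (2 * r).
  have -> : x0 + (2 * c i) *: e = t *: (x0 + r *: e) + (1 - t) *: (x0 - r *: e).
    by apply/rowP => j; rewrite !mxE /t; field; rewrite gt_eqF.
  have := cr i; rewrite ler_norml => /andP[cl cu].
  have t0 : 0 <= t by rewrite /t divr_ge0//; lra.
  have t1 : t <= 1 by rewrite /t ler_pdivrMr ?mulr_gt0//; lra.
  apply: le_trans (convex_h _ _ t0 t1) _; apply: lerD.
    by apply: le_trans (ler_wpM2l t0 (ler_norm _)) _; rewrite ler_piMl.
  have u0 : 0 <= 1 - t by lra.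
  by apply: le_trans (ler_wpM2l u0 (ler_norm _)) _; rewrite ler_piMl//; lra.
lra.
Qed.

Lemma convex_bounded_ball (x0 : 'rV[R]_n) :
  exists r M : R, 0 < r /\ forall y, enorm (y - x0) <= r -> h y <= M.
Proof.
have [r [M [r0 H]]] := convex_bounded_box x0 (index_enum 'I_n).
exists r, M; split=> // y yr.
have -> : y = x0 + \sum_i (y - x0) 0 i *: delta_mx 0 i.
  by rewrite -row_sum_delta addrC subrK.
by apply: H => i; apply: le_trans (coord_le_enorm _ _) yr.
Qed.

(** The upper bound M on a ball becomes a lower bound 2 h x0 - M by reflection in x0. Convexity then
    bounds the slope from x to y by the oscillation, at most 2 D, over the length r / 2 gained
    beyond y. *)
Lemma convex_locally_lipschitz (x0 : 'rV[R]_n) :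
  exists d L : R, 0 < d /\ forall x y, enorm (x - x0) < d -> enorm (y - x0) < d ->
    h y - h x <= L * enorm (y - x).
Proof.
have [r [M [r0 HM]]] := convex_bounded_ball x0.
have M0 : h x0 <= M by apply: HM; rewrite subrr enorm0 ltW.
pose D := M - h x0; have D0 : 0 <= D by rewrite subr_ge0.
exists (r / 2), (2 * D / (r / 2)); split=> [|x y xr yr]; first by rewrite divr_gt0.
have hx : 2 * h x0 - M <= h x.
  have := convex_h x (2 *: x0 - x) (t := 2^-1).
  have -> : 2^-1 *: x + (1 - 2^-1) *: (2 *: x0 - x) = x0.
    by apply/rowP => i; rewrite !mxE; field.
  have : h (2 *: x0 - x) <= M.
    apply: HM; rewrite (_ : _ - x0 = - (x - x0)) ?enormN; first by lra.
    by apply/rowP => i; rewrite !mxE; ring.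
  by move=> H1 /(_ _ _)/wrap[]; lra.
(* Extend the segment from x beyond y up to a point z of the larger ball. *)
have [xy|xy] := eqVneq (enorm (y - x)) 0.
  by move/enorm_eq0/eqP : (xy); rewrite subr_eq0 => /eqP ->; rewrite !subrr enorm0 mulr0.
have e0 : 0 < enorm (y - x) by rewrite lt_neqAle eq_sym xy enorm_ge0.
set e := enorm (y - x) in xy e0 *; set q := r / 2 in xr yr *.
have q0 : 0 < q by rewrite divr_gt0.
pose z := y + (q / e) *: (y - x).
have hz : h z <= M.
  apply: HM; rewrite (_ : _ - _ = (y - x0) + (q / e) *: (y - x)).
    apply: le_trans (enormD _ _) _; rewrite enormZ gtr0_norm ?divr_gt0//.
    by rewrite -/e divfK//; have : r = q + q; [rewrite /q; lra|lra].
  by rewrite /z; apply/rowP => i; rewrite !mxE; ring.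
(* Chosen so that y = l z + (1 - l) x; l <= e / q then produces the Lipschitz constant. *)
pose l := e / (q + e).
have l0 : 0 <= l by rewrite divr_ge0 ?addr_ge0 ?ltW.
have l1 : l <= 1 by rewrite ler_pdivrMr ?addr_gt0// mul1r lerDr ltW.
have yE : l *: z + (1 - l) *: x = y.
  apply/rowP => i; rewrite /z /l !mxE; field.
  by rewrite xy gt_eqF// addr_gt0.
have := convex_h z x l0 l1; rewrite yE => hy.
have : h z - h x <= 2 * D by rewrite /D; lra.
move=> /(ler_wpM2l l0) H1.
apply: (@le_trans _ _ (l * (2 * D))); first by lra.
have lq : l <= e / q.
  by rewrite /l ler_wpM2l ?(ltW e0)// lef_pV2 ?posrE ?addr_gt0// lerDl ltW.
rewrite [leRHS]mulrAC -mulrA mulrC; apply: ler_wpM2l lq.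
by rewrite mulr_ge0.
Qed.
End LocalLipschitz.

(** phi is the finite convex function h minus a parabola, whose Lipschitz constant on the ball is at
    most 2 c B, where B bounds the norms there. *)
Lemma proximal_locally_lipschitz (R : realType) (n : nat) (mu : R)
    (phi : 'rV[R]_n -> \bar R) :
  0 < mu -> (forall x, phi x \is a fin_num) -> proximal mu phi ->
  locally_lipschitz phi.
Proof.
move=> mu0 fphi prox_phi; split=> // x0.
set c := (2 * mu)^-1; pose h x := fine (phi x) + c * inner x x.
have c0 : 0 <= c by rewrite invr_ge0 mulr_ge0 ?ltW.
have convex_h x y (t : R) : 0 <= t -> t <= 1 ->
    h (t *: x + (1 - t) *: y) <= t * h x + (1 - t) * h y.
  rewrite le_eqVlt => /predU1P[<- _|t0].
    by rewrite scale0r add0r subr0 scale1r mul0r add0r mul1r.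
  rewrite le_eqVlt => /predU1P[->|t1].
    by rewrite subrr !scale0r addr0 scale1r mul0r addr0 mul1r.
  have px z : (phi z <= (fine (phi z))%:E)%E by rewrite fineK.
  have := proximal_le prox_phi t0 t1 (px x) (px y).
  rewrite -[X in (X <= _)%E -> _]fineK// lee_fin -/c /h !innerE (innerC y x).
  by lra.
have [d [L [d0 HL]]] := convex_locally_lipschitz convex_h x0.
pose B := enorm x0 + d.
exists d, (L + c * (B + B)); split=> //.
suff H x y : enorm (x - x0) < d -> enorm (y - x0) < d ->
    fine (phi y) - fine (phi x) <= (L + c * (B + B)) * enorm (y - x).
  move=> x y xd yd; rewrite ler_norml; apply/andP; split; last exact: H.
  by rewrite lerNl opprB enormB; exact: H.
move=> xd yd.
have nB z : enorm (z - x0) < d -> enorm z <= B.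
  move=> zd; have := enormD (z - x0) x0; rewrite subrK => /le_trans; apply.
  by rewrite addrC lerD2l ltW.
have := HL _ _ xd yd; rewrite /h => H1.
have H2 : inner x x - inner y y <= (B + B) * enorm (y - x).
  have -> : inner x x - inner y y = inner (- (y + x)) (y - x).
    by rewrite !innerE (innerC y x); ring.
  apply: le_trans (cauchy_schwarz _ _) _; rewrite ler_wpM2r ?enorm_ge0// enormN.
  by apply: le_trans (enormD _ _) _; rewrite lerD ?nB.
have := ler_wpM2l c0 H2; lra.
Qed.

(** * Moreau envelopes below the prox threshold *)

Section MoreauEnvelope.
Context {R : realType} {n : nat} (mu : R) (f : 'rV[R]_n -> \bar R).
Hypotheses (mu_gt0 : 0 < mu) (f_proper : proper_efun f).
Hypothesis mu_lt : (mu%:E < prox_threshold f)%E.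
Let c := (2 * mu)^-1.

Lemma moreau_env_le z w : (moreau_env mu f w <= f z + (c * inner (z - w) (z - w))%:E)%E.
Proof. by apply: ereal_inf_lbound; exists z => //; rewrite enorm_sqr. Qed.

(** As mu lies below a supremum, some admissible lambda exceeds it; an envelope value above -oo at
    one point is a quadratic minorant, of curvature below that of c |.|^2. *)
Lemma quadratic_minorant : exists (lambda C : R) (x0 : 'rV[R]_n),
  mu < lambda /\
  forall z, (C%:E <= f z + ((2 * lambda)^-1 * inner (z - x0) (z - x0))%:E)%E.
Proof.
have [_ [lambda [l0 [x0 env0]] <-] ml] := ereal_sup_gt mu_lt.
have [C HC] : exists C : R, (C%:E <= moreau_env lambda f x0)%E.
  by move: env0; case: (moreau_env _ _ _) => [C||]// _; [exists C|exists 0; rewrite leey].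
exists lambda, C, x0; split=> [|z]; first by rewrite -lte_fin.
apply: le_trans HC _; rewrite -enorm_sqr.
by apply: ereal_inf_lbound; exists z.
Qed.

Lemma moreau_env_fin w : moreau_env mu f w \is a fin_num.
Proof.
have [fNy [z0 dz0]] := f_proper.
have up : (moreau_env mu f w < +oo)%E.
  apply: le_lt_trans (moreau_env_le z0 w) _.
  by move: dz0; rewrite /dom/=; case: (f z0) => //= r _; rewrite -EFinD ltry.
rewrite fin_real// up andbT.
have [lambda [C [x0 [ml HC]]]] := quadratic_minorant.
have l0 : 0 < lambda by exact: lt_trans ml.
set b := (2 * lambda)^-1 in HC.
have b0 : 0 < b by rewrite invr_gt0 mulr_gt0.
have bc : b < c by rewrite ltf_pV2 ?posrE ?mulr_gt0// ltr_pM2l.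
(* The maximum over u of b |u + v|^2 - c |u|^2 for v = w - x0, finite because b < c. *)
pose K := c * b / (c - b) * inner (w - x0) (w - x0).
apply: (@lt_le_trans _ _ (C - K)%:E); first exact: ltNyr.
apply/ereal_infP => _ [z _ <-]; rewrite enorm_sqr -/c.
move: (HC z) (fNy z); case: (f z) => [r||]// H _; last by rewrite leey.
rewrite -EFinD lee_fin; move: H; rewrite -EFinD lee_fin.
set u := z - w; set v := w - x0; have -> : z - x0 = u + v by rewrite /u /v addrA subrK.
move=> H; suff : b * inner (u + v) (u + v) <= c * inner u u + K by lra.
have d0 : 0 < c - b by rewrite subr_gt0.
(* Young: the difference of the two sides is |(c - b) u - b v|^2 / (c - b) *)
have := inner_ge0 ((c - b) *: u - b *: v).
have -> : inner ((c - b) *: u - b *: v) ((c - b) *: u - b *: v) =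
   (c - b) * (c * inner u u + K - b * inner (u + v) (u + v)).
  rewrite /K -/v; move: u v {H} => u v; rewrite !innerE (innerC v u); field.
  by rewrite gt_eqF.
by rewrite pmulr_rge0// subr_ge0.
Qed.

Definition moreau_envr w := fine (moreau_env mu f w).

Lemma moreau_envrE w : moreau_env mu f w = (moreau_envr w)%:E.
Proof. by rewrite fineK// moreau_env_fin. Qed.

Lemma moreau_envr_le z w (s : R) : (f z <= s%:E)%E ->
  moreau_envr w <= s + c * inner (z - w) (z - w).
Proof.
move=> fs; have := moreau_env_le z w; rewrite moreau_envrE => /le_trans.
by move=> /(_ _ (leeD2r _ fs)); rewrite -EFinD lee_fin.
Qed.

Lemma le_moreau_envr w (a : R) :
  (forall z (s : R), (f z <= s%:E)%E -> a <= s + c * inner (z - w) (z - w)) ->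
  a <= moreau_envr w.
Proof.
have [fNy _] := f_proper.
move=> H; rewrite -lee_fin -moreau_envrE; apply/ereal_infP => _ [z _ <-].
rewrite enorm_sqr -/c; case E : (f z) (fNy z) => [s||]// _; last by rewrite leey.
by rewrite -EFinD lee_fin; apply: H; rewrite E.
Qed.

(** Fenchel-Young inequality for F = f + c |.|^2: the conjugate of F at 2 c w is c |w|^2 - e_mu f w,
    so finite envelopes mean a finite conjugate. *)
Lemma add_quad_ge z w :
  ((moreau_envr w - c * inner w w + 2 * c * inner w z)%:E <= add_quad mu f z)%E.
Proof.
have [fNy _] := f_proper.
rewrite /add_quad enorm_sqr -/c.
case E : (f z) (fNy z) => [s||]// _; last by rewrite leey.
have := @moreau_envr_le z w s; rewrite E lexx => /(_ isT).
by rewrite -EFinD lee_fin !innerE (innerC z w); lra.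
Qed.

Lemma add_quad_bounded_below : exists m0 : R, forall z, (m0%:E <= add_quad mu f z)%E.
Proof.
exists (moreau_envr 0) => z.
by have := add_quad_ge z 0; rewrite !inner0l !mulr0 subr0 addr0.
Qed.

(** At w = [e i] and w = [- e i] the minorants of [add_quad_ge] have slopes plus and minus a basis
    vector, so on a sublevel set they bound each coordinate from both sides. *)
Lemma add_quad_level_bounded (s : R) :
  exists B, forall z, (add_quad mu f z <= s%:E)%E -> enorm z <= B.
Proof.
have c0 : 0 < c by rewrite invr_gt0 mulr_gt0.
pose e (i : 'I_n) : 'rV[R]_n := (2 * c)^-1 *: delta_mx 0 i.
pose b w : R := `|moreau_envr w - c * inner w w|.
pose B0 : R := \sum_i (b (e i) + b (- e i)).
exists (n.+1%:R * (`|s| + B0)) => z zs; apply: le_trans (enorm_le_norm z) _.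
rewrite ler_wpM2l//; apply: rV_norm_le => [|i].
  apply: addr_ge0; first exact: normr_ge0.
  by apply: sumr_ge0 => i _; apply: addr_ge0; exact: normr_ge0.
have He w : moreau_envr w - c * inner w w + 2 * c * inner w z <= s.
  by rewrite -lee_fin; apply: le_trans (add_quad_ge z w) zs.
have ez : 2 * c * inner (e i) z = z 0 i.
  rewrite innerZl mulrA divff ?mul1r ?gt_eqF ?mulr_gt0//.
  rewrite /inner (bigD1 i)//= big1 ?addr0 => [|k ki]; rewrite !mxE eqxx/= ?eqxx ?mul1r//.
  by rewrite (negbTE ki) mul0r.
have Bi : b (e i) + b (- e i) <= B0.
  rewrite /B0 (bigD1 i)//= lerDl; apply: sumr_ge0 => k _.
  by apply: addr_ge0; exact: normr_ge0.
have bw w : - (moreau_envr w - c * inner w w) <= b w by rewrite /b -normrN ler_norm.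
have := He (e i); rewrite ez; have := He (- e i); rewrite (innerNl (e i) z) mulrN ez.
have := bw (e i); have := bw (- e i); have := ler_norm s.
have b0 w : 0 <= b w by exact: normr_ge0.
have := b0 (e i); have := b0 (- e i).
by move=> *; rewrite ler_norml; apply/andP; split; lra.
Qed.
End MoreauEnvelope.

(** * Strong duality by quadratic penalization *)

Section Duality.
Context {R : realType}.

(** Direct method: near-minimizers lie in the compact sublevel set of level i + 1, and a cluster
    point lies in every sublevel set of level i + e. *)
Lemma lsc_argmin (m : nat) (K : 'rV[R]_m -> \bar R) (m0 : R) :
  lower_semicontinuous K -> (forall p, (m0%:E <= K p)%E) ->
  (forall s : R, exists B, forall p, (K p <= s%:E)%E -> enorm p <= B) ->
  (exists p, (K p < +oo)%E) ->
  exists (p : 'rV[R]_m) (k : R), K p = k%:E /\ forall q, (k%:E <= K q)%E.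
Proof.
move=> lK mK bK [p0 p0K]; set I := ereal_inf (range K).
have I0 : (m0%:E <= I)%E by apply/ereal_infP => _ [p _ <-].
have I1 : (I < +oo)%E.
  by apply: le_lt_trans p0K; apply: ereal_inf_lbound; exists p0.
have fI : I \is a fin_num.
  by rewrite fin_real// I1 andbT; apply: lt_le_trans I0; exact: ltNyr.
pose i := fine I; have Ii : I = i%:E by rewrite /i fineK.
have iK p : (i%:E <= K p)%E by rewrite -Ii; apply: ereal_inf_lbound; exists p.
have approx (k : nat) : exists p, (K p <= (i + k.+1%:R^-1)%:E)%E.
  have : (I < (i + k.+1%:R^-1)%:E)%E by rewrite Ii lte_fin ltrDl invr_gt0.
  by move=> /ereal_inf_lt[_ [p _ <-]] /ltW Kp; exists p.
have [p_ Kp_] := choice approx.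
have [B HB] := bK (i + 1).
have cA : compact [set p | (K p <= (i + 1)%:E)%E].
  by apply: bounded_closed_compact; [exact: (bounded_enorm HB)|exact: lsc_closed].
have [k|p Hp] := compact_seq (u := p_) cA.
  apply: le_trans (Kp_ k) _; rewrite lee_fin lerD2l invf_le1 ?ltr0n//.
  by rewrite ler1n.
exists p, i; split=> //; apply/eqP; rewrite eq_le iK andbT.
apply/lee_addgt0Pr => e e0; rewrite -EFinD.
apply: (Hp _ (@lsc_closed _ _ _ (i + e) lK)).
near=> k; apply: le_trans (Kp_ k) _; rewrite lee_fin lerD2l ltW//.
by near: k; exact: near_infty_natSinv_lt (PosNum e0).
Unshelve. all: by end_near. Qed.

Context {m n : nat} (L : 'rV[R]_m -> \bar R) (A : 'M[R]_(m, n)) (x : 'rV[R]_n).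
Let r p := x - p *m A.

(* The residual at a minimizer of L + k/2 |r|^2 yields the multiplier k r p. *)
Lemma penalized_argmin_subgradient (k l : R) (p : 'rV[R]_m) :
  0 <= k -> convex_efun L -> L p = l%:E ->
  (forall q, ((l + k / 2 * inner (r p) (r p))%:E <=
              L q + (k / 2 * inner (r q) (r q))%:E)%E) ->
  forall q, ((l + k * inner (r p) (r p))%:E <= L q + (inner (k *: r p) (r q))%:E)%E.
Proof.
move=> k0 cL Lp pmin q.
case Lq : (L q) (pmin q) => [s||]// _; last by rewrite leey.
rewrite -EFinD lee_fin; set D := r p - r q.
have rq : r q = r p - D by rewrite /D opprB addrC subrK.
rewrite rq innerZl innerBr.
rewrite -subr_le0; apply: (@le0_eps _ _ 1) => // e e0.
(* Moving p by a fraction t towards q turns the residual into r p - t D; after division by t the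
   leftover is t (k / 2) |D|^2, at most e. *)
have M0 : 0 < k / 2 * inner D D + 1.
  by rewrite ltr_wpDl// mulr_ge0 ?inner_ge0 ?divr_ge0.
have [t [t0 t1 _ tM]] := small_step ltr01 e0 ltr01 M0.
have Lp' : (L p <= l%:E)%E by rewrite Lp.
have Lq' : (L q <= s%:E)%E by rewrite Lq.
have := pmin (t *: q + (1 - t) *: p).
have -> : r (t *: q + (1 - t) *: p) = r p - t *: D.
  rewrite /D /r mulmxDl -!scalemxAl; apply/rowP => i; rewrite !mxE; ring.
have := convex_efun_le cL t0 t1 Lq' Lp'.
move=> /(leeD2r (k / 2 * inner (r p - t *: D) (r p - t *: D))%:E) H /le_trans/(_ H).
clear rq; clearbody D; move: (r p) => u.
rewrite -EFinD lee_fin !innerE (innerC D u) => H1.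
rewrite mulr1 -(ler_pM2l t0); have := ler_wpM2l (ltW t0) tM; nra.
Qed.

(** The last hypothesis bounds all dual values by S. A minimizer p of L + (k + 1) / 2 |r|^2 has a
    multiplier certifying the dual value L p + (k + 1) |r p|^2, so L p <= S and |r p|^2 <= (S - m0)
    / (k + 1); a cluster point of these minimizers is feasible. *)
Lemma lagrange_duality (m0 S : R) :
  lower_semicontinuous L -> convex_efun L -> (forall p, (m0%:E <= L p)%E) ->
  (forall s : R, exists B, forall p, (L p <= s%:E)%E -> enorm p <= B) ->
  (forall w (b : R), (forall p, (b%:E <= L p + (inner w (r p))%:E)%E) -> b <= S) ->
  exists p, p *m A = x /\ (L p <= S%:E)%E.
Proof.
move=> lL cL mL bL HS.
have [p0 p0L] : exists p, (L p < +oo)%E.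
  apply: contrapT => /forallNP noL.
  (* If L were +oo everywhere, S + 1 would be a dual value for the multiplier 0. *)
  suff : S + 1 <= S by lra.
  apply: (HS 0) => p; have /negP := noL p.
  by rewrite -leNgt leye_eq => /eqP ->; rewrite leey.
have cr : continuous r.
  move=> p; apply: (@cvgB _ _ _ (nbhs p)); first exact: cvg_cst.
  by have := @continuous_mulmxr R m n A p.
have crr : continuous (fun p => inner (r p) (r p)).
  by move=> p; apply: (@cvg_inner _ _ _ (nbhs p)); exact: cr.
have approx (k : nat) : exists p, (L p <= S%:E)%E /\
    k.+1%:R * inner (r p) (r p) <= S - m0.
  pose K p := (L p + (k.+1%:R / 2 * inner (r p) (r p))%:E)%E.
  have k0 : 0 <= k.+1%:R / 2 :> R by rewrite divr_ge0.
  have q0 p : 0 <= k.+1%:R / 2 * inner (r p) (r p) by rewrite mulr_ge0 ?inner_ge0.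
  have LK p : (L p <= K p)%E by rewrite /K leeDl// lee_fin.
  have LNy p : (-oo < L p)%E by apply: lt_le_trans (mL p); exact: ltNyr.
  have [||||p [v [Kp pmin]]] := @lsc_argmin _ K m0.
  - apply: lscD => //; first by move=> p; exact: ltNyr.
    apply: (@lsc_continuous _ _ (fun p => k.+1%:R / 2 * inner (r p) (r p))) => p.
    by apply: (@cvgM _ _ (nbhs p)); [exact: cvg_cst|exact: crr].
  - by move=> p; apply: le_trans (LK p).
  - by move=> s; have [B HB] := bL s; exists B => p /(le_trans (LK p)); exact: HB.
  - by exists p0; rewrite /K; case: (L p0) p0L => //= l _; rewrite -EFinD ltry.
  have [l Lp] : exists l, L p = l%:E.
    by move: Kp (LNy p); rewrite /K; case: (L p) => // l _ _; exists l.
  have vE : v = l + k.+1%:R / 2 * inner (r p) (r p).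
    by move: Kp; rewrite /K Lp -EFinD => -[].
  rewrite vE in pmin.
  have := HS _ _ (penalized_argmin_subgradient (ler0n _ _) cL Lp pmin).
  have := mL p; rewrite Lp !lee_fin => ml lS.
  exists p; rewrite Lp lee_fin; split; last by lra.
  by have := q0 p; lra.
have [p_ Hp_] := choice approx.
have [B HB] := bL S.
have cA : compact [set p | (L p <= S%:E)%E].
  by apply: bounded_closed_compact; [exact: (bounded_enorm HB)|exact: lsc_closed].
have [k|p Hp] := compact_seq (u := p_) cA; first by have [] := Hp_ k.
exists p; split; last first.
  by apply: (Hp _ (@lsc_closed _ _ _ S lL)); apply: nearW => k; have [] := Hp_ k.
suff : inner (r p) (r p) <= 0.
  rewrite -enorm_sqr => rp0; apply/esym/eqP; rewrite -subr_eq0; apply/eqP/enorm_eq0.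
  by apply/eqP; rewrite -sqrf_eq0 eq_le rp0 sqr_ge0.
have Sm : 0 < S - m0 + 1.
  have := Hp_ 0%N => -[_]; rewrite mul1r => H.
  by have := inner_ge0 (r (p_ 0%N)); lra.
apply: (le0_eps Sm) => e e0.
have cD : closed [set q | inner (r q) (r q) <= e * (S - m0 + 1)].
  by apply: (@closed_comp _ _ (fun q => inner (r q) (r q)) [set y | y <= _]);
    [move=> q _; exact: crr|exact: closed_le].
apply: (Hp _ cD); near=> k.
have [_ Hk] := Hp_ k; rewrite /= -(ler_pM2l (ltr0Sn R k)).
apply: le_trans Hk _; have : 1 <= k.+1%:R * e.
  rewrite mulrC -ler_pdivrMr// div1r ltW//.
  by near: k; exact: near_infty_natSinv_lt (PosNum e0).
nra.
Unshelve. all: by end_near. Qed.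
End Duality.

(** * The proximal average *)

Lemma convex_set_segment (R : realType) (M : lmodType R) (A : set M) :
  (forall x y (t : R), 0 < t -> t < 1 -> A x -> A y -> A (t *: x + (1 - t) *: y)) ->
  @convex_set R M A.
Proof.
move=> H; apply/convex_setW => x y; rewrite !inE => Ax Ay k k0 k1.
by rewrite inE; exact: H.
Qed.

(** * Suprema of parabolas of a common curvature *)

Section ParabolaSup.
Context {R : realType} {n : nat} (c : R) (psi : 'rV[R]_n -> R).
Context (phi : 'rV[R]_n -> \bar R).
Hypothesis phi_le : forall x a,
  (phi x <= a%:E)%E <-> forall w, psi w - c * inner (w - x) (w - x) <= a.

Lemma parabola_sup_ge x w : ((psi w - c * inner (w - x) (w - x))%:E <= phi x)%E.
Proof.
case E : (phi x) => [a||]; last 2 first.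
- by rewrite leey.
(* The value -oo is excluded by the parabola with w = x, which exceeds the bound psi x - 1 at x. *)
- have : (phi x <= (psi x - 1)%:E)%E by rewrite E leNye.
  by move=> /phi_le/(_ x); rewrite subrr inner0l mulr0 subr0 => H; exfalso; clear E; lra.
by rewrite lee_fin; apply: (phi_le x a).1; rewrite E.
Qed.

Lemma parabola_supNy x : (-oo < phi x)%E.
Proof. by apply: lt_le_trans (parabola_sup_ge x x); exact: ltNyr. Qed.

Lemma lsc_parabola_sup : lower_semicontinuous phi.
Proof.
move=> x a ax.
have [w Hw] : exists w, a < psi w - c * inner (w - x) (w - x).
  apply: contrapT => /forallNP H; move: ax; rewrite ltNge => /negP; apply.
  by apply/phi_le => w; rewrite leNgt; apply/negP.
exists [set y | a < psi w - c * inner (w - y) (w - y)]; last first.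
  by move=> y /= ay; apply: lt_le_trans (parabola_sup_ge y w); rewrite lte_fin.
have wx : w - y @[y --> x] --> w - x.
  by apply: (@cvgB _ _ _ (nbhs x)); [exact: cvg_cst|exact: cvg_id].
have H : psi w - c * inner (w - y) (w - y) @[y --> x] -->
    psi w - c * inner (w - x) (w - x).
  apply: (@cvgB _ _ _ (nbhs x)); first exact: cvg_cst.
  apply: (@cvgM _ _ (nbhs x)); first exact: cvg_cst.
  exact: (@cvg_inner _ _ _ (nbhs x)).
exact: cvgr_gt H _ Hw.
Qed.

(** Adding c |x|^2 to psi w - c |w - x|^2 leaves an affine function of x, so convexity is checked
    for each w separately. *)
Lemma proximal_parabola_sup (mu : R) : c = (2 * mu)^-1 -> proximal mu phi.
Proof.
move=> cE; apply: convex_efun_of_le => [x|x y t a b t0 t1].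
  exact/add_quadNy/parabola_supNy.
rewrite !add_quad_le -cE => /phi_le xa /phi_le yb; apply/phi_le => w.
have := ler_wpM2l (ltW t0) (xa w).
have u0 : 0 <= 1 - t by rewrite subr_ge0 ltW.
have := ler_wpM2l u0 (yb w).
by rewrite !innerE (innerC x w) (innerC y w) (innerC y x); lra.
Qed.
End ParabolaSup.

Section EpiMult.
Context {R : realType} {n : nat} (h : 'rV[R]_n -> \bar R).
Hypothesis h_proper : proper_efun h.

Lemma epi_multNy a u : 0 <= a -> (-oo < epi_mult a h u)%E.
Proof.
have [hNy _] := h_proper.
rewrite /epi_mult le_eqVlt => /predU1P[<-|a0]; first by rewrite eqxx; case: ifP.
rewrite gt_eqF//; move: (hNy (a^-1 *: u)); case: (h _) => [r||]// _.
  by rewrite -EFinM ltNyr.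
by rewrite gt0_muley ?lte_fin.
Qed.

(** One criterion for weight 0 and for positive weights, so the convolution formula needs no case
    distinction. For a = 0, properness supplies a point z where h is finite. *)
Lemma epi_mult_le a u (r : R) : 0 <= a ->
  (epi_mult a h u <= r%:E)%E <->
  exists z (s : R), [/\ (h z <= s%:E)%E, a *: z = u & a * s <= r].
Proof.
have [hNy [z0 dz0]] := h_proper.
rewrite /epi_mult le_eqVlt => /predU1P[<-|a0].
  rewrite eqxx; split=> [|[z [s [_ <- H]]]]; last first.
    by rewrite scale0r eqxx lee_fin; move: H; rewrite mul0r.
  case: eqP => [-> r0|_]; last by rewrite leye_eq.
  exists z0, (fine (h z0)); rewrite scale0r mul0r fineK; first by split.
  by rewrite fin_real// hNy.
rewrite gt_eqF//; split=> [H|[z [s [zs <- H]]]].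
  exists (a^-1 *: u), (a^-1 * r).
  rewrite scalerA !mulVKf ?gt_eqF// divff ?gt_eqF// scale1r.
  by split=> //; rewrite EFinM lee_pdivlMl.
rewrite scalerA mulVf ?gt_eqF// scale1r.
by rewrite -lee_pdivlMl// -EFinM; apply: le_trans zs _; rewrite lee_fin ler_pdivlMl.
Qed.
End EpiMult.

Section ProximalAverage.
Context {R : realType} {n : nat} (f g : 'rV[R]_n -> \bar R) (mu alpha : R).
Hypotheses (f_proper : proper_efun f) (g_proper : proper_efun g).
Hypotheses (mu_gt0 : 0 < mu) (mu_ltf : (mu%:E < prox_threshold f)%E).
Hypotheses (mu_ltg : (mu%:E < prox_threshold g)%E).
Hypotheses (alpha_ge0 : 0 <= alpha) (alpha_le1 : alpha <= 1).
Let c := (2 * mu)^-1.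
Let phi := prox_average mu alpha f g.
Let psi w := alpha * moreau_envr mu f w + (1 - alpha) * moreau_envr mu g w.
Let beta_ge0 : 0 <= 1 - alpha. Proof. by rewrite subr_ge0. Qed.

(** The negated infimum of - psi + c |. - x|^2 is the supremum of psi - c |. - x|^2; finite
    envelopes let the computation take place in R. *)
Lemma prox_average_le x (a : R) : (phi x <= a%:E)%E <->
  forall w, psi w - c * inner (w - x) (w - x) <= a.
Proof.
have E w : (- alpha%:E * moreau_env mu f w - (1 - alpha)%:E * moreau_env mu g w
    + ((2 * mu)^-1 * enorm (w - x) ^+ 2)%:E)%E
    = (- (psi w - c * inner (w - x) (w - x)))%:E.
  rewrite !moreau_envrE// enorm_sqr -!(EFinN, EFinM, EFinD); congr (_%:E).
  by rewrite /psi -/c; ring.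
rewrite /phi /prox_average leeNl; split=> [/ereal_infP H w|H].
  by have := H _ (ex_intro2 _ _ w I (erefl _)); rewrite E lee_fin lerN2.
by apply/ereal_infP => _ [w _ <-]; rewrite E lee_fin lerN2.
Qed.

Let phiNy := parabola_supNy prox_average_le.

Lemma lsc_prox_average : lower_semicontinuous phi.
Proof. exact: lsc_parabola_sup prox_average_le. Qed.

Lemma proximal_prox_average : proximal mu phi.
Proof. exact: (proximal_parabola_sup prox_average_le). Qed.

(** This is (A). Weight e_mu f w <= s + c |z - w|^2 and its analogue for g, and subtract c |w - x|^2
    at x = alpha z + (1 - alpha) z': all terms in w cancel. *)
Lemma prox_average_le_average z z' (s s' : R) :
  (f z <= s%:E)%E -> (g z' <= s'%:E)%E ->
  (add_quad mu phi (alpha *: z + (1 - alpha) *: z')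
     <= (alpha * (s + c * inner z z) + (1 - alpha) * (s' + c * inner z' z'))%:E)%E.
Proof.
move=> fs gs; rewrite add_quad_le -/c; apply/prox_average_le => w.
have := ler_wpM2l alpha_ge0 (moreau_envr_le mu_gt0 f_proper mu_ltf w fs).
have := ler_wpM2l beta_ge0 (moreau_envr_le mu_gt0 g_proper mu_ltg w gs).
rewrite /psi -/c !innerE (innerC w z) (innerC w z') (innerC z' z).
lra.
Qed.

Lemma proper_prox_average : proper_efun phi.
Proof.
split; first exact: phiNy.
have [fNy [z dz]] := f_proper; have [gNy [z' dz']] := g_proper.
exists (alpha *: z + (1 - alpha) *: z').
have fz : (f z <= (fine (f z))%:E)%E by rewrite fineK// fin_real// fNy.
have gz : (g z' <= (fine (g z'))%:E)%E by rewrite fineK// fin_real// gNy.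
have := prox_average_le_average fz gz; rewrite add_quad_le => H.
by apply: le_lt_trans H _; exact: ltry.
Qed.

(** For fixed z' in [dom g], the y with alpha y + (1 - alpha) z' in [dom phi] form a convex set
    containing [dom f], hence the whole space; alpha > 0 lets every x be written this way. *)
Lemma dom_prox_average_full : 0 < alpha -> conv_hull (dom f) = [set: 'rV[R]_n] ->
  forall x, dom phi x.
Proof.
move=> alpha_gt0 convf x.
have [fNy [z dz]] := f_proper; have [gNy [z' dz']] := g_proper.
pose D : set 'rV[R]_n := [set y | dom phi (alpha *: y + (1 - alpha) *: z')].
have convD : @convex_set R 'rV[R]_n D.
  apply: convex_set_segment => y1 y2 t t0 t1 Dy1 Dy2.
  have E : alpha *: (t *: y1 + (1 - t) *: y2) + (1 - alpha) *: z' =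
      t *: (alpha *: y1 + (1 - alpha) *: z')
      + (1 - t) *: (alpha *: y2 + (1 - alpha) *: z').
    by apply/rowP => i; rewrite !mxE; ring.
  have := proximal_dom_convex proximal_prox_average phiNy t0 t1 Dy1 Dy2.
  by rewrite -E.
have subD : dom f `<=` D.
  move=> y dy.
  have fy : (f y <= (fine (f y))%:E)%E by rewrite fineK// fin_real// fNy.
  have gz : (g z' <= (fine (g z'))%:E)%E by rewrite fineK// fin_real// gNy.
  have := prox_average_le_average fy gz; rewrite add_quad_le => H.
  by apply: le_lt_trans H _; exact: ltry.
pose y : 'rV[R]_n := alpha^-1 *: (x - (1 - alpha) *: z').
have E : alpha *: y + (1 - alpha) *: z' = x.
  by rewrite /y scalerA divff ?gt_eqF// scale1r subrK.
have : conv_hull (dom f) y by rewrite convf.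
by move=> /(smallest_sub convD subD); rewrite /D/= E.
Qed.
End ProximalAverage.

Lemma prox_averageC (R : realType) (n : nat) (mu alpha : R)
    (f g : 'rV[R]_n -> \bar R) :
  (forall x, moreau_env mu f x \is a fin_num) ->
  (forall x, moreau_env mu g x \is a fin_num) ->
  prox_average mu alpha f g = prox_average mu (1 - alpha) g f.
Proof.
move=> ff fg; apply/funext => x; rewrite /prox_average; congr (- moreau_env _ _ _)%E.
apply/funext => w; rewrite subKr -(fineK (ff w)) -(fineK (fg w)).
by rewrite -!(EFinN, EFinM, EFinD); congr (_%:E); ring.
Qed.

(** Fenchel-Moreau for F = f + c |.|^2, for the weights 0 and 1: the hypothesis bounds the
    biconjugate of F at x, and duality with the constraint p = x bounds F itself. *)
Lemma proximal_biconjugate_le (R : realType) (n : nat) (mu : R)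
    (f : 'rV[R]_n -> \bar R) (x : 'rV[R]_n) (S : R) :
  0 < mu -> proper_efun f -> (mu%:E < prox_threshold f)%E ->
  lower_semicontinuous f -> proximal mu f ->
  (forall w, moreau_envr mu f w - (2 * mu)^-1 * inner (w - x) (w - x)
     <= S - (2 * mu)^-1 * inner x x) ->
  (add_quad mu f x <= S%:E)%E.
Proof.
move=> mu0 f_proper mu_lt lsc_f prox_f H; set c := (2 * mu)^-1 in H *.
have c0 : 0 < c by rewrite invr_gt0 mulr_gt0.
have [fNy _] := f_proper.
have [m0 Hm0] := add_quad_bounded_below mu0 f_proper mu_lt.
have [] := @lagrange_duality R n n (add_quad mu f) 1%:M x m0 S.
- exact: lsc_add_quad.
- exact: prox_f.
- exact: Hm0.
- exact: add_quad_level_bounded.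
(* Completing the square, F z - <w, z> = f z + c |z - v|^2 - c |v|^2, so the dual function is an
   envelope value at v. *)
- move=> w b Hb; pose v := (2 * c)^-1 *: w.
  have wv u : inner w u = 2 * c * inner v u.
    by rewrite innerZl mulrA divff ?mul1r// gt_eqF// mulr_gt0.
  clearbody v.
  have : b - inner w x + c * inner v v <= moreau_envr mu f v.
    apply: (le_moreau_envr mu0 f_proper mu_lt) => z s zs.
    have zs' : (add_quad mu f z <= (s + c * inner z z)%:E)%E by rewrite add_quad_le addrK.
    have := Hb z; rewrite mulmx1 -leeBlDr// -EFinB => /le_trans/(_ zs').
    by rewrite lee_fin -/c !innerE !wv (innerC z v); lra.
  by have := H v; rewrite wv !innerE (innerC x v); lra.
by move=> p [<-]; rewrite mulmx1.
Qed.

(** * The convolution formula for proximal functions *)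

Section ConvexProximalAverage.
Context {R : realType} {n : nat} (f g : 'rV[R]_n -> \bar R) (mu alpha : R).
Hypotheses (f_proper : proper_efun f) (g_proper : proper_efun g).
Hypotheses (lsc_f : lower_semicontinuous f) (lsc_g : lower_semicontinuous g).
Hypotheses (mu_gt0 : 0 < mu) (mu_ltf : (mu%:E < prox_threshold f)%E).
Hypotheses (mu_ltg : (mu%:E < prox_threshold g)%E).
Hypotheses (prox_f : proximal mu f) (prox_g : proximal mu g).
Hypotheses (alpha_ge0 : 0 <= alpha) (alpha_le1 : alpha <= 1).
Let c := (2 * mu)^-1.
Let phi := prox_average mu alpha f g.

(** Duality on pairs (z, z') for alpha F z + (1 - alpha) G z' under alpha z + (1 - alpha) z' = x.
    The dual values are governed by the envelopes at w / (2 c), hence by the supremum defining phi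
    x; positive weights make the level sets bounded in both components. *)
Lemma prox_average_split_interior x (S : R) : 0 < alpha -> alpha < 1 ->
  (add_quad mu phi x <= S%:E)%E ->
  exists z z' (s s' : R), [/\ (add_quad mu f z <= s%:E)%E,
    (add_quad mu g z' <= s'%:E)%E, alpha *: z + (1 - alpha) *: z' = x &
    alpha * s + (1 - alpha) * s' <= S].
Proof.
move=> alpha_gt0 alpha_lt1.
have beta_gt0 : 0 < 1 - alpha by rewrite subr_gt0.
have c0 : 0 < c by rewrite invr_gt0 mulr_gt0.
have [fNy _] := f_proper; have [gNy _] := g_proper.
rewrite add_quad_le => /(prox_average_le alpha f_proper g_proper mu_gt0 mu_ltf mu_ltg) H.
rewrite -/c in H.
have FNy z : (-oo < add_quad mu f z)%E by exact: add_quadNy.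
have GNy z : (-oo < add_quad mu g z)%E by exact: add_quadNy.
pose L (p : 'rV[R]_(n + n)) := (alpha%:E * add_quad mu f (lsubmx p)
   + (1 - alpha)%:E * add_quad mu g (rsubmx p))%E.
pose A : 'M[R]_(n + n, n) := col_mx alpha%:M (1 - alpha)%:M.
have pA p : p *m A = alpha *: lsubmx p + (1 - alpha) *: rsubmx p.
  by rewrite -[p in LHS]hsubmxK mul_row_col !mul_mx_scalar.
have scNy (a : R) (h : \bar R) : 0 < a -> (-oo < h)%E -> (-oo < a%:E * h)%E.
  move=> a0; case: h => [r||]// _; first by rewrite -EFinM ltNyr.
  by rewrite gt0_muley ?lte_fin.
have L_split p (s : R) : (L p <= s%:E)%E -> exists u v : R,
    [/\ (add_quad mu f (lsubmx p) <= u%:E)%E,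
        (add_quad mu g (rsubmx p) <= v%:E)%E & alpha * u + (1 - alpha) * v <= s].
  rewrite /L; move: (FNy (lsubmx p)) (GNy (rsubmx p)).
  case: (add_quad mu f _) (add_quad mu g _) => [u||] [v||]// _ _.
  - by rewrite -!EFinM -EFinD lee_fin => uv; exists u, v.
  - by rewrite gt0_muley ?lte_fin// addey// leye_eq.
  - by rewrite gt0_muley ?lte_fin// addye// leye_eq.
  - by rewrite !gt0_muley ?lte_fin// leye_eq.
have L_le p (u v : R) : (add_quad mu f (lsubmx p) <= u%:E)%E ->
    (add_quad mu g (rsubmx p) <= v%:E)%E ->
    (L p <= (alpha * u + (1 - alpha) * v)%:E)%E.
  move=> pu pv; rewrite [leRHS]EFinD !EFinM.
  by apply: leeD; apply: lee_wpmul2l; rewrite ?lee_fin// ltW.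
have LNy p : (-oo < L p)%E.
  rewrite /L; move: (scNy _ _ alpha_gt0 (FNy (lsubmx p)))
    (scNy _ _ beta_gt0 (GNy (rsubmx p))).
  by case: (_ * _)%E (_ * _)%E => [u||] [v||]// _ _; rewrite -EFinD ltNyr.
have [mf Hmf] := add_quad_bounded_below mu_gt0 f_proper mu_ltf.
have [mg Hmg] := add_quad_bounded_below mu_gt0 g_proper mu_ltg.
have [] := @lagrange_duality R (n + n) n L A x (alpha * mf + (1 - alpha) * mg) S.
- apply: lscD => [p|p||].
  + exact: scNy.
  + exact: scNy.
  + apply: lscZ => //.
    apply: (lsc_comp (f := add_quad mu f) (@continuous_lsubmx _ 1 n n)).
    exact: lsc_add_quad.
  + apply: lscZ => //.
    apply: (lsc_comp (f := add_quad mu g) (@continuous_rsubmx _ 1 n n)).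
    exact: lsc_add_quad.
- apply: convex_efun_of_le => // p q t a b t0 t1 /L_split[u1 [v1 [pu pv uv1]]].
  move=> /L_split[u2 [v2 [qu qv uv2]]].
  have := L_le (t *: p + (1 - t) *: q); rewrite !linearD !linearZ/= => H1.
  have := H1 _ _ (convex_efun_le prox_f t0 t1 pu qu) (convex_efun_le prox_g t0 t1 pv qv).
  move=> /le_trans; apply; rewrite lee_fin.
  have u0 : 0 <= 1 - t by rewrite subr_ge0 ltW.
  have := ler_wpM2l (ltW t0) uv1; have := ler_wpM2l u0 uv2; lra.
- move=> p; rewrite /L [leLHS]EFinD !EFinM.
  by apply: leeD; apply: lee_wpmul2l => //; rewrite lee_fin ltW.
- move=> s.
  have [Bf HBf] := add_quad_level_bounded mu_gt0 f_proper mu_ltf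
    (alpha^-1 * (s - (1 - alpha) * mg)).
  have [Bg HBg] := add_quad_level_bounded mu_gt0 g_proper mu_ltg
    ((1 - alpha)^-1 * (s - alpha * mf)).
  exists (Bf + Bg) => p /L_split[u [v [pu pv uv]]].
  have mu_u : mf <= u by rewrite -lee_fin; exact: le_trans (Hmf _) pu.
  have mv : mg <= v by rewrite -lee_fin; exact: le_trans (Hmg _) pv.
  have := ler_wpM2l (ltW alpha_gt0) mu_u; have := ler_wpM2l (ltW beta_gt0) mv => H1 H2.
  have nf : enorm (lsubmx p) <= Bf.
    by apply: HBf; apply: le_trans pu _; rewrite lee_fin ler_pdivlMl//; lra.
  have ng : enorm (rsubmx p) <= Bg.
    by apply: HBg; apply: le_trans pv _; rewrite lee_fin ler_pdivlMl//; lra.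
  apply: le_trans (lerD nf ng).
  rewrite -ler_sqr ?nnegrE ?addr_ge0 ?enorm_ge0// -[p in leLHS]hsubmxK enorm_sqr.
  rewrite inner_row_mx sqrrD !enorm_sqr.
  have := mulr_ge0 (enorm_ge0 (lsubmx p)) (enorm_ge0 (rsubmx p)); lra.
- move=> w b Hb; pose v := (2 * c)^-1 *: w.
  have wv u : inner w u = 2 * c * inner v u.
    by rewrite innerZl mulrA divff ?mul1r// gt_eqF// mulr_gt0.
  clearbody v.
  have Hb' z z' (s s' : R) : (f z <= s%:E)%E -> (g z' <= s'%:E)%E ->
      b <= alpha * (s + c * inner z z) + (1 - alpha) * (s' + c * inner z' z')
           + inner w (x - (alpha *: z + (1 - alpha) *: z')).
    move=> fs gs; have := Hb (row_mx z z'); rewrite pA row_mxKl row_mxKr.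
    have := L_le (row_mx z z') (s + c * inner z z) (s' + c * inner z' z').
    rewrite row_mxKl row_mxKr !add_quad_le !addrK => /(_ fs gs).
    move=> /(leeD2r (inner w (x - (alpha *: z + (1 - alpha) *: z')))%:E) H1.
    move=> /le_trans/(_ H1).
    by rewrite -EFinD lee_fin.
  suff H1 : b - inner w x + c * inner v v <=
      alpha * moreau_envr mu f v + (1 - alpha) * moreau_envr mu g v.
    by have := H v; rewrite wv in H1; rewrite !innerE (innerC x v); lra.
  (* The infima are taken in turn: over z' with the envelope of f held constant, then over z. *)
  rewrite [leRHS]addrC -lerBlDr -ler_pdivrMl//.
  apply: (le_moreau_envr mu_gt0 g_proper mu_ltg) => z' s' gs.
  rewrite -/c ler_pdivrMl// lerBlDr -lerBlDl -ler_pdivrMl//.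
  apply: (le_moreau_envr mu_gt0 f_proper mu_ltf) => z s fs.
  rewrite -/c ler_pdivrMl//; have := Hb' _ _ _ _ fs gs.
  by rewrite !innerE !wv (innerC z v) (innerC z' v); lra.
move=> p [pAx /L_split[u [v [pu pv uv]]]].
by exists (lsubmx p), (rsubmx p), u, v; rewrite -pA.
Qed.

(** At the weights 0 and 1, the point of weight zero is any point of its domain and the other one is
    x, by [proximal_biconjugate_le]. *)
Lemma prox_average_split x (S : R) : (add_quad mu phi x <= S%:E)%E ->
  exists z z' (s s' : R), [/\ (add_quad mu f z <= s%:E)%E,
    (add_quad mu g z' <= s'%:E)%E, alpha *: z + (1 - alpha) *: z' = x &
    alpha * s + (1 - alpha) * s' <= S].
Proof.
have pt (h : 'rV[R]_n -> \bar R) : proper_efun h ->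
    exists z (s : R), (add_quad mu h z <= s%:E)%E.
  move=> [hNy [z dz]]; exists z, (fine (h z) + c * inner z z).
  by rewrite add_quad_le addrK fineK// fin_real// hNy.
have [/eqP al0|al0] := boolP (alpha == 0).
  rewrite add_quad_le.
  move=> /(prox_average_le alpha f_proper g_proper mu_gt0 mu_ltf mu_ltg) H.
  have [z [s zs]] := pt _ f_proper.
  exists z, x, s, S; rewrite al0 scale0r subr0 scale1r add0r mul0r add0r mul1r.
  split=> //; apply: proximal_biconjugate_le => // w.
  by have := H w; rewrite al0 mul0r add0r subr0 mul1r.
have [/eqP al1|al1] := boolP (alpha == 1).
  rewrite add_quad_le.
  move=> /(prox_average_le alpha f_proper g_proper mu_gt0 mu_ltf mu_ltg) H.
  have [z [s zs]] := pt _ g_proper.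
  exists x, z, S, s; rewrite al1 subrr scale0r scale1r addr0 mul0r addr0 mul1r.
  split=> //; apply: proximal_biconjugate_le => // w.
  by have := H w; rewrite al1 subrr mul0r addr0 mul1r.
by apply: prox_average_split_interior; rewrite lt_neqAle ?al1// eq_sym al0.
Qed.

(** (A), read through [epi_mult_le], gives one inequality; [prox_average_split] gives the other,
    with attainment where the value is finite. *)
Lemma add_quad_prox_average x : add_quad mu phi x =
  inf_conv (epi_mult alpha (add_quad mu f)) (epi_mult (1 - alpha) (add_quad mu g)) x.
Proof.
have beta_ge0 : 0 <= 1 - alpha by rewrite subr_ge0.
have quad_proper (h : 'rV[R]_n -> \bar R) : proper_efun h -> proper_efun (add_quad mu h).
  move=> [hNy [z dz]]; split=> [y|]; first exact: add_quadNy.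
  exists z; move: dz; rewrite /dom/= /add_quad; case: (h z) => //= r _.
  by rewrite -EFinD ltry.
have qf := quad_proper _ f_proper; have qg := quad_proper _ g_proper.
have phiNy : (-oo < add_quad mu phi x)%E.
  apply: add_quadNy.
  by case: (proper_prox_average f_proper g_proper mu_gt0 mu_ltf mu_ltg alpha_ge0 alpha_le1).
apply/eqP; rewrite eq_le; apply/andP; split.
  apply/ereal_infP => _ [w _ <-].
  have := epi_multNy qf (x - w) alpha_ge0; have := epi_multNy qg w beta_ge0.
  case Eg : (epi_mult (1 - alpha) _ w) => [r'||]//;
    case Ef : (epi_mult alpha _ _) => [r||]// _ _.
  - have /epi_mult_le : (epi_mult (1 - alpha) (add_quad mu g) w <= r'%:E)%E by rewrite Eg.
    move=> /(_ qg beta_ge0)[z' [s' [gz' zw' sr']]].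
    have /epi_mult_le : (epi_mult alpha (add_quad mu f) (x - w) <= r%:E)%E by rewrite Ef.
    move=> /(_ qf alpha_ge0)[z [s [fz zw sr]]].
    rewrite add_quad_le in fz; rewrite add_quad_le in gz'.
    have := prox_average_le_average f_proper g_proper mu_gt0 mu_ltf mu_ltg
      alpha_ge0 alpha_le1 fz gz'.
    rewrite zw zw' subrK !subrK => /le_trans; apply.
    by rewrite -EFinD lee_fin lerD.
  - by rewrite leey.
  - by rewrite leey.
  - by rewrite leey.
case E : (add_quad mu phi x) phiNy => [S||]// _; last by rewrite leey.
have [|z [z' [s [s' [fz gz' <- sS]]]]] := @prox_average_split x S; first by rewrite E.
apply: (@le_trans _ _ (alpha * s + (1 - alpha) * s')%:E); last by rewrite lee_fin.
apply: ge_ereal_inf; exists (epi_mult alpha (add_quad mu f) (alpha *: z)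
   + epi_mult (1 - alpha) (add_quad mu g) ((1 - alpha) *: z'))%E.
  by exists ((1 - alpha) *: z') => //; rewrite addrK.
rewrite EFinD; apply: leeD; apply/epi_mult_le => //.
  by exists z, s.
by exists z', s'.
Qed.
End ConvexProximalAverage.

(** In (b) the function whose domain has full hull must carry positive weight: for alpha = 0 the
    average is built from g alone, for alpha = 1 from f alone. *)
Theorem proposition5p2 (R : realType) (n : nat) (f g : 'rV[R]_n -> \bar R)
    (mu alpha : R)
    (proper_f : proper_efun f) (lsc_f : lower_semicontinuous f)
    (pb_f : prox_bounded f)
    (proper_g : proper_efun g) (lsc_g : lower_semicontinuous g)
    (pb_g : prox_bounded g)
    (mu_gt0 : 0 < mu)
    (mu_lt : (mu%:E < Order.min (prox_threshold f) (prox_threshold g))%E)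
    (alpha_ge0 : 0 <= alpha) (alpha_le1 : alpha <= 1) :
  [/\ forall x, dom (prox_average mu alpha f g) x ->
        [/\ clarke_regular (prox_average mu alpha f g) x,
            prox_regular (prox_average mu alpha f g) x &
            strongly_amenable (prox_average mu alpha f g) x],
      (0 < alpha /\ conv_hull (dom f) = [set: 'rV[R]_n]) \/
      (alpha < 1 /\ conv_hull (dom g) = [set: 'rV[R]_n]) ->
        locally_lipschitz (prox_average mu alpha f g)
    & proximal mu f -> proximal mu g ->
        forall x, prox_average mu alpha f g x =
          (inf_conv (epi_mult alpha (add_quad mu f))
                    (epi_mult (1 - alpha) (add_quad mu g)) x
           - ((2 * mu)^-1 * enorm x ^+ 2)%:E)%E].
Proof.
move: mu_lt; rewrite lt_min => /andP[mu_ltf mu_ltg].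
have phi_proper := proper_prox_average proper_f proper_g mu_gt0 mu_ltf mu_ltg
  alpha_ge0 alpha_le1.
have [phiNy _] := phi_proper.
have phi_lsc := @lsc_prox_average R n f g mu alpha proper_f proper_g mu_gt0 mu_ltf mu_ltg.
have phi_prox :=
  @proximal_prox_average R n f g mu alpha proper_f proper_g mu_gt0 mu_ltf mu_ltg.
split.
- move=> x dx; split.
  + exact: proximal_clarke_regular phi_prox _ _.
  + exact: proximal_prox_regular phi_prox _ _.
  + exact: proximal_strongly_amenable phi_prox _ _.
- move=> conv; suff fphi x : dom (prox_average mu alpha f g) x.
    by apply: (proximal_locally_lipschitz mu_gt0 _ phi_prox) => x;
      rewrite fin_real// phiNy fphi.
  case: conv => -[al conv].
    exact: (dom_prox_average_full proper_f proper_g).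
  (* Exchanging f and g turns the weight alpha into 1 - alpha and reduces to the previous case. *)
  rewrite prox_averageC; [|exact: moreau_env_fin..].
  have b0 : 0 <= 1 - alpha by rewrite subr_ge0.
  have b1 : 1 - alpha <= 1 by rewrite lerBlDr lerDl.
  have b0' : 0 < 1 - alpha by rewrite subr_gt0.
  exact: (dom_prox_average_full proper_g proper_f).
- move=> prox_f prox_g x.
  rewrite -(add_quad_prox_average proper_f proper_g lsc_f lsc_g)//.
  by rewrite /add_quad addeK.
Qed.
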